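(* Let $A,C,\eta,N_0$ and $u_0$, $u_0^N$ be as in the context, with $u_0$ not identically zero. For each integer $N>N_0$ with $Q_N:=\sum_{k=0}^N u_0(k/N)>0$, let $(p_0,\dots,p_N)$ be the solution of the linear ODE system $$\dot p_k=a_{k-1}p_{k-1}-(a_k+c_k)p_k+c_{k+1}p_{k+1},\qquad k=0,\dots,N,$$ where $a_k=N A(k/N)$ and $c_k=N C(k/N)$ for $0\le k\le N$ and $a_{-1}=c_{N+1}=0$ (the corresponding terms are absent), with initial conditions $p_k(0)=u_0(k/N)/Q_N$ for $k=0,1,\dots,N$. Let $v$ (depending on $N$) be the solution of the Fokker-Planck equation $$\partial_t v(t,z)=\frac1{2N}\partial_{zz}\big((A(z)+C(z))v(t,z)\big)-\partial_z\big((A(z)-C(z))v(t,z)\big),\qquad z\in[-h,1+h],$$ subject to the boundary conditions $$\frac1{2N}\partial_z((A+C)v)(t,z)-((A-C)v)(t,z)=0\quad\text{for } z=-h \text{ and } z=1+h,$$ and the initial condition $v(0,\cdot)=u_0^N/Q_N$. Then for any $t_0>0$ there exists a constant $K$, independent of $N$, such that $$\left|v\!\left(t,\tfrac kN\right)-p_k(t)\right|\le \frac KN\qquad\text{for all } t\in[0,t_0],\ k=0,1,\dots,N,$$ for all such $N$.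
   Context: Let $\eta>0$ and let $A,C\in C^4[-\eta,1+\eta]$ be real-valued functions, non-negative on $[0,1]$, with $A+C>0$ on $[-\eta,1+\eta]$, $A(1)=C(0)=0$, $A-C>0$ on $[-\eta,0]$ and $A-C<0$ on $[1,1+\eta]$. Let $N_0>1/(2\eta)$ be a positive integer such that $2N_0|A(x)-C(x)|>|A'(x)+C'(x)|$ for all $x\in[-\eta,0]\cup[1,1+\eta]$. For each $N$ put $h=\frac1{2N}$. Let $u_0\in C^2[0,1]$ be a non-negative function with $u_0(0)=u_0'(0)=u_0(1)=u_0'(1)=0$, such that its extension $u_0^N$ to $[-h,1+h]$ by the constant $0$ outside $[0,1]$ belongs to $C^2[-h,1+h]$. The solution of the Fokker-Planck equation with initial function $f$ is understood as $S_N(t)f$, where $(S_N(t))_{t\ge0}$ is the (analytic, strongly continuous) semigroup on $C[-h,1+h]$ (complex-valued functions, sup norm) generated by $\mathcal A_N f=\frac1{2N}((A+C)f)''-((A-C)f)'$ with domain $D(\mathcal A_N)=\{f\in C^2[-h,1+h]: \frac1{2N}((A+C)f)'(z)-((A-C)f)(z)=0 \text{ for } z=-h,\,1+h\}$. *)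

(* Defs.v *)
From Stdlib Require Export Reals.
From Coquelicot Require Export Coquelicot.
Open Scope R_scope.

Definition Icc (a b x : R) : Prop := a <= x <= b.

Section Calculus.
Context {V : CompleteNormedModule R_AbsRing}.

(* [is_derive] with [locally x] restricted to [D], hence the one-sided
   derivative at an end point of an interval. *)
Definition is_derive_within (D : R -> Prop) (f : R -> V) (x : R) (l : V) : Prop :=
  filterdiff f (within D (locally x)) (fun y : R => scal y l).

Definition Derive_within (D : R -> Prop) (f : R -> V) (x : R) : V :=
  iota (is_derive_within D f x).

Fixpoint Cn_on (D : R -> Prop) (n : nat) (f : R -> V) : Prop :=
  match n with
  | O => continuous_on D f
  | S m => exists f' : R -> V,
      (forall x, D x -> is_derive_within D f x (f' x)) /\ Cn_on D m f'
  end.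

End Calculus.

(* Elements of the complex Banach space C[a,b] are represented by functions
   R -> C, of which only the restriction to D = [a,b] matters; two of them are
   identified when they agree on D. *)
Section Semigroup.
Variable D : R -> Prop.

Definition cont (f : R -> C) : Prop := continuous_on D f.

(* Only used on functions continuous on a compact interval, where the least
   upper bound is finite. *)
Definition sup_norm (f : R -> C) : R :=
  real (Lub_Rbar (fun r => exists x, D x /\ r = Cmod (f x))).

Record C0_semigroup (S : R -> (R -> C) -> R -> C) : Prop := {
  sg_cont : forall t f, 0 <= t -> cont f -> cont (S t f);
  sg_linear : forall t (al be : C) f g, 0 <= t -> cont f -> cont g ->
    forall x, D x ->
      S t (fun y => (al * f y + be * g y)%C) x
      = (al * S t f x + be * S t g x)%C;
  sg_bounded : forall t, 0 <= t ->
    exists M : R, forall f, cont f -> sup_norm (S t f) <= M * sup_norm f;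
  sg_zero : forall f, cont f -> forall x, D x -> S 0 f x = f x;
  sg_add : forall s t f, 0 <= s -> 0 <= t -> cont f ->
    forall x, D x -> S (s + t) f x = S s (S t f) x;
  sg_strong : forall f, cont f ->
    filterlim (fun t => sup_norm (fun x => (S t f x - f x)%C))
      (at_right 0) (locally 0)
}.

Definition generator_rel (S : R -> (R -> C) -> R -> C) (f g : R -> C) : Prop :=
  filterlim
    (fun t => sup_norm (fun x => ((S t f x - f x) / RtoC t - g x)%C))
    (at_right 0) (locally 0).

Definition is_generator (S : R -> (R -> C) -> R -> C)
    (dom : (R -> C) -> Prop) (G : (R -> C) -> R -> C) : Prop :=
  forall f g, cont f -> cont g ->
    (generator_rel S f g <-> dom f /\ forall x, D x -> g x = G f x).

End Semigroup.

Section FokkerPlanck.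
Variables (fA fC : R -> R) (N : nat).

Definition mesh : R := 1 / (2 * INR N).

Definition dom_interval : R -> Prop := Icc (- mesh) (1 + mesh).

Definition DC (f : R -> C) : R -> C :=
  Derive_within (V := C_R_CompleteNormedModule) dom_interval f.

Definition diff_part (f : R -> C) (z : R) : C := (RtoC (fA z + fC z)%R * f z)%C.
Definition drift_part (f : R -> C) (z : R) : C := (RtoC (fA z - fC z)%R * f z)%C.

Definition FP_op (f : R -> C) (z : R) : C :=
  (RtoC mesh * DC (DC (diff_part f)) z - DC (drift_part f) z)%C.

Definition FP_flux (f : R -> C) (z : R) : C :=
  (RtoC mesh * DC (diff_part f) z - drift_part f z)%C.

Definition FP_dom (f : R -> C) : Prop :=
  Cn_on (V := C_R_CompleteNormedModule) dom_interval 2 f /\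
  FP_flux f (- mesh) = RtoC 0 /\ FP_flux f (1 + mesh) = RtoC 0.

(* A C_0-semigroup is determined by its generator, so this fixes S t f on
   [-h, 1+h] for every t >= 0 and every continuous f. *)
Definition FP_semigroup (S : R -> (R -> C) -> R -> C) : Prop :=
  C0_semigroup dom_interval S /\ is_generator dom_interval S FP_dom FP_op.

Definition rate_up (k : nat) : R := INR N * fA (INR k / INR N).
Definition rate_down (k : nat) : R := INR N * fC (INR k / INR N).

Definition master_rhs (p : nat -> R -> R) (k : nat) (t : R) : R :=
  (match k with O => 0 | S j => rate_up j * p j t end)
  - (rate_up k + rate_down k) * p k t
  + (if Nat.ltb k N then rate_down (S k) * p (S k) t else 0).

Definition master_solution (p : nat -> R -> R) (p0 : nat -> R) : Prop :=
  forall k, (k <= N)%nat ->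
    p k 0 = p0 k /\
    forall t, 0 <= t ->
      is_derive_within (V := R_CompleteNormedModule)
        (fun s => 0 <= s) (p k) t (master_rhs p k t).

End FokkerPlanck.

Definition ext0 (u : R -> R) (z : R) : R :=
  if Rle_dec 0 z then (if Rle_dec z 1 then u z else 0) else 0.

Definition Qsum (u : R -> R) (N : nat) : R :=
  sum_f_R0 (fun k => u (INR k / INR N)) N.

Definition C_on (n : nat) (a b : R) (f : R -> R) : Prop :=
  Cn_on (V := R_CompleteNormedModule) (Icc a b) n f.

Definition D_on (a b : R) (f : R -> R) : R -> R :=
  Derive_within (V := R_CompleteNormedModule) (Icc a b) f.

(* Main.v *)
From Stdlib Require Import Lra Lia Classical IndefiniteDescription FunctionalExtensionality.
Require Import Defs.

(** Conservation of total probability is of no help here: it controls the l1 norm, in which the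
    discrete initial data have size 1, not 1/N. The main obstacle is that [C0_semigroup] bounds each
    operator [S t] separately and gives continuity of orbits only at time 0. The Gronwall argument
    has to pass to limits from the left, and left continuity of an orbit needs a bound that is
    uniform on compact time intervals; this is why a uniform boundedness principle is proved for the
    semigroup. The growth constant w bounds h (A'' + C'') - (A' - C'), the zeroth-order coefficient
    of the expanded operator, and is independent of N because h <= 1. The exponent contains 2 w
    because 1 / (1 - s w) is estimated by 1 + 2 s w for small s. [gronwall_induction] is stated for
    an abstract predicate so that one continuation argument serves both the semigroup and the ODE
    system. *)

(* Since u0 >= 0 is continuous and not identically zero, Q_N >= c N for some c > 0,
   so the initial data u0 / Q_N are O(1/N) in the sup norm and it suffices that
   both evolutions expand the sup norm by at most a factor independent of N on
   [0, t0]; the difference needs no further estimate.  For the ODE system this holds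
   because the off-diagonal rates are non-negative and the row sums of its matrix
   are at most sup|A'| + sup|C'|.  For the Fokker-Planck semigroup, the operator minus
   a constant is dissipative: the zero-flux condition and 2 N |A - C| > |A' + C'| keep
   the maximum of |f| away from the end points.  The semigroup is only given
   through its generator, so the growth bound is derived from dissipativity along orbits
   in the domain, which contains the initial datum. *)

(** * Derivatives within an interval *)

Lemma within_locally_eps (D : R -> Prop) (x : R) (P : R -> Prop) :
  within D (locally x) P ->
  exists d, 0 < d /\ forall y, D y -> Rabs (y - x) < d -> P y.
Proof.
  intros [d Hd]; exists d; split; [apply cond_pos|].
  intros y Dy Hy; apply Hd; [exact Hy|exact Dy].
Qed.

Lemma is_filter_lim_within (D : R -> Prop) (x : R) :
  is_filter_lim (within D (locally x)) x.
Proof. intros P HP. unfold within. now apply filter_imp with P. Qed.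

Lemma within_proper (D : R -> Prop) (x : R) :
  D x -> ProperFilter (within D (locally x)).
Proof.
  intros Dx; split; [|apply within_filter; apply locally_filter].
  intros P [d Hd]; exists x; apply Hd; [apply ball_center|exact Dx].
Qed.

(** [filterdiff] quantifies over every limit of its filter; this reduces that quantifier to the base
    point. *)
Lemma is_filter_lim_within_unique (D : R -> Prop) (x y : R) :
  D x -> is_filter_lim (within D (locally x)) y -> x = y.
Proof.
  intros Dx H. pose proof (within_proper D x Dx) as PF.
  exact (is_filter_lim_unique (F := within D (locally x)) x y
           (is_filter_lim_within D x) H).
Qed.

(** A non-degenerate interval has no isolated points, end points included; uniqueness of the
    derivative within it rests on this. *)
Lemma Icc_near a b x d :
  a < b -> Icc a b x -> 0 < d -> exists y, Icc a b y /\ 0 < Rabs (y - x) /\ Rabs (y - x) < d.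
Proof.
  unfold Icc; intros ab [H1 H2] Hd. destruct (Rlt_dec x b) as [Hx|Hx].
  - exists (x + Rmin (d / 2) (b - x)).
    assert (0 < Rmin (d / 2) (b - x)) by (apply Rmin_pos; lra).
    pose proof (Rmin_l (d / 2) (b - x)). pose proof (Rmin_r (d / 2) (b - x)).
    replace (x + Rmin (d / 2) (b - x) - x) with (Rmin (d / 2) (b - x)) by ring.
    rewrite Rabs_pos_eq; lra.
  - exists (x - Rmin (d / 2) (x - a)).
    assert (0 < Rmin (d / 2) (x - a)) by (apply Rmin_pos; lra).
    pose proof (Rmin_l (d / 2) (x - a)). pose proof (Rmin_r (d / 2) (x - a)).
    replace (x - Rmin (d / 2) (x - a) - x) with (- Rmin (d / 2) (x - a)) by ring.
    rewrite Rabs_Ropp, Rabs_pos_eq; lra.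
Qed.

Lemma minus_minus_l {G : AbelianGroup} (w l m : G) :
  minus l m = minus (minus w m) (minus w l).
Proof.
  rewrite (minus_trans w l m), plus_comm, <- (opp_minus w l). reflexivity.
Qed.

(** The normed-module axiom gives the opposite inequality; applied to [/ k] and [scal k v] it yields
    this one. *)
Lemma norm_scal_ge {V : NormedModule R_AbsRing} (k : R) (v : V) :
  Rabs k * norm v <= norm (scal k v).
Proof.
  destruct (Req_dec k 0) as [->|Hk].
  { rewrite Rabs_R0, Rmult_0_l. apply norm_ge_0. }
  pose proof (Rabs_pos_lt k Hk) as Hp.
  assert (E : v = scal (/ k) (scal k v)).
  { rewrite scal_assoc. replace (mult (/ k) k) with (@one R_AbsRing).
    - symmetry; apply scal_one.
    - symmetry; apply Rinv_l, Hk. }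
  assert (H : norm v <= / Rabs k * norm (scal k v)).
  { rewrite E at 1. rewrite <- Rabs_inv. apply (norm_scal (V := V)). }
  apply (Rmult_le_compat_l _ _ _ (Rlt_le _ _ Hp)) in H.
  rewrite <- Rmult_assoc, Rinv_r, Rmult_1_l in H; [exact H|lra].
Qed.

Lemma norm_minus_le {K : AbsRing} {V : NormedModule K} (u v : V) :
  norm (minus u v) <= norm u + norm v.
Proof. rewrite <- (norm_opp v). apply norm_triangle. Qed.

Section Within.
Context {V : CompleteNormedModule R_AbsRing}.
Implicit Types (D : R -> Prop) (f : R -> V) (x : R) (l : V).

Lemma is_derive_within_eps D f x l :
  is_derive_within D f x l -> forall eps, 0 < eps ->
  exists d, 0 < d /\ forall y, D y -> Rabs (y - x) < d ->
    norm (minus (minus (f y) (f x)) (scal (y - x) l)) <= eps * Rabs (y - x).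
Proof.
  intros [_ H] eps He.
  specialize (H x (is_filter_lim_within D x) (mkposreal eps He)).
  exact (within_locally_eps _ _ _ H).
Qed.

Lemma is_derive_within_continuous D f x l :
  is_derive_within D f x l -> filterlim f (within D (locally x)) (locally (f x)).
Proof.
  intros H.
  apply (@filterdiff_continuous_aux R_AbsRing (AbsRing_NormedModule R_AbsRing) V).
  - apply within_filter, locally_filter.
  - eexists; exact H.
  - apply is_filter_lim_within.
Qed.

Lemma is_derive_within_continuous_on D f (f' : R -> V) :
  (forall x, D x -> is_derive_within D f x (f' x)) -> continuous_on D f.
Proof. intros H x Dx. exact (is_derive_within_continuous D f x _ (H x Dx)). Qed.

Lemma is_derive_within_subset D D' f x l :
  (forall y, D' y -> D y) -> D' x ->
  is_derive_within D f x l -> is_derive_within D' f x l.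
Proof.
  intros HD D'x [Hl H]; split; [exact Hl|].
  intros z Hz. rewrite <- (is_filter_lim_within_unique D' x z D'x Hz).
  intros eps. generalize (H x (is_filter_lim_within D x) eps).
  unfold within. apply filter_imp. auto.
Qed.

Lemma is_derive_within_ext D f g x l :
  D x -> (forall y, D y -> f y = g y) ->
  is_derive_within D f x l -> is_derive_within D g x l.
Proof.
  intros Dx He H. apply filterdiff_ext_loc with f.
  - exists (mkposreal 1 Rlt_0_1). auto.
  - intros z Hz. rewrite <- (is_filter_lim_within_unique D x z Dx Hz). auto.
  - exact H.
Qed.

Lemma is_derive_within_plus D f g x l m :
  is_derive_within D f x l -> is_derive_within D g x m ->
  is_derive_within D (fun y => plus (f y) (g y)) x (plus l m).
Proof.
  intros Hf Hg. unfold is_derive_within.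
  eapply filterdiff_ext_lin.
  - apply (filterdiff_plus_fct f g _ _ Hf Hg).
  - intros y; simpl. symmetry; apply (scal_distr_l (V := V)).
Qed.

Lemma is_derive_within_scal D (b : R -> R) f x (db : R) l :
  D x ->
  is_derive_within (V := R_CompleteNormedModule) D b x db ->
  is_derive_within D f x l ->
  is_derive_within D (fun y => scal (b y) (f y)) x
    (plus (scal db (f x)) (scal (b x) l)).
Proof.
  intros Dx Hb Hf. unfold is_derive_within.
  pose proof (within_proper D x Dx) as PF.
  pose proof (is_derive_within_continuous _ _ _ _ Hf) as Cf.
  assert (Cb : filterlim b (within D (locally x)) (locally (b x))).
  { apply (@filterdiff_continuous_aux R_AbsRing
             (AbsRing_NormedModule R_AbsRing) (AbsRing_NormedModule R_AbsRing)).
    - apply PF.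
    - eexists; exact Hb.
    - apply is_filter_lim_within. }
  eapply filterdiff_ext_lin.
  - apply (filterdiff_comp_2 (U := R_NormedModule) (V := V) (W := V)
             b f (fun u v => scal u v) _ _
             (fun u v => plus (scal u (f x)) (scal (b x) v)) Hb Hf).
    apply (filterdiff_scal (V := V) (b x, f x)).
    + intros P HP. unfold filtermap.
      apply (filterlim_pair (F := within D (locally x)) b f
        Cb Cf).
      destruct HP as [e He].
      apply (Filter_prod _ _ _ (ball (b x) e) (ball (f x) e)).
      * now exists e.
      * now exists e.
      * intros u v Hu Hv; apply He; split; assumption.
    + intros n m; apply Rmult_comm.
  - intros y; simpl.
    rewrite scal_distr_l, !scal_assoc. f_equal. f_equal. apply Rmult_comm.
Qed.

Lemma is_derive_within_unique a b f x l m :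
  a < b -> Icc a b x ->
  is_derive_within (Icc a b) f x l -> is_derive_within (Icc a b) f x m -> l = m.
Proof.
  intros ab Dx Hl Hm. apply NNPP; intros Hne.
  pose proof (norm_minus_gt_0 _ _ Hne) as Hn. set (n := norm (minus l m)) in Hn.
  (* Any tolerance below n / 2 would do: the two errors must add up to less than n |y - x|. *)
  assert (Hn3 : 0 < n / 3) by (apply Rdiv_lt_0_compat; [exact Hn|lra]).
  destruct (is_derive_within_eps _ _ _ _ Hl (n / 3) Hn3) as [d1 [d1p H1]].
  destruct (is_derive_within_eps _ _ _ _ Hm (n / 3) Hn3) as [d2 [d2p H2]].
  destruct (Icc_near a b x (Rmin d1 d2) ab Dx (Rmin_pos _ _ d1p d2p))
    as [y [Dy [Hy0 Hy]]].
  specialize (H1 y Dy (Rlt_le_trans _ _ _ Hy (Rmin_l _ _))).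
  specialize (H2 y Dy (Rlt_le_trans _ _ _ Hy (Rmin_r _ _))).
  set (w := minus (f y) (f x)) in *.
  assert (E : scal (y - x) (minus l m)
    = minus (minus w (scal (y - x) m)) (minus w (scal (y - x) l))).
  { transitivity (minus (scal (y - x) l) (scal (y - x) m));
      [apply (scal_minus_distr_l (V := V))|apply minus_minus_l]. }
  assert (E2 : Rabs (y - x) * n <= norm (scal (y - x) (minus l m)))
    by apply (norm_scal_ge (V := V)).
  assert (E3 : norm (scal (y - x) (minus l m)) <= n / 3 * Rabs (y - x) + n / 3 * Rabs (y - x)).
  { rewrite E. eapply Rle_trans; [apply (norm_minus_le (V := V))|].
    apply Rplus_le_compat; assumption. }
  nra.
Qed.

Lemma Derive_within_correct a b f x l :
  a < b -> Icc a b x ->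
  is_derive_within (Icc a b) f x l -> Derive_within (Icc a b) f x = l.
Proof.
  intros ab Dx H. apply iota_unique; [|exact H].
  intros m Hm. now apply (is_derive_within_unique a b f x).
Qed.

Lemma Cn_on_continuous D n f : Cn_on D n f -> continuous_on D f.
Proof.
  destruct n; [auto|]. intros [f' [H _]] x Dx.
  exact (is_derive_within_continuous _ _ _ _ (H x Dx)).
Qed.
End Within.

Lemma is_derive_within_linear {V W : CompleteNormedModule R_AbsRing}
  (L : V -> W) (D : R -> Prop) (f : R -> V) (x : R) (l : V) :
  is_linear L -> is_derive_within D f x l ->
  is_derive_within D (fun y => L (f y)) x (L l).
Proof.
  intros HL H. unfold is_derive_within.
  eapply filterdiff_ext_lin.
  - apply (filterdiff_comp (U := AbsRing_NormedModule R_AbsRing) (V := V) (W := W)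
             f L _ L H). apply filterdiff_linear, HL.
  - intros y; simpl. apply (linear_scal L HL).
Qed.

Lemma scal_C (b : R) (z : C) : scal (V := C_R_NormedModule) b z = (RtoC b * z)%C.
Proof.
  destruct z as [u v]. unfold Cmult; simpl.
  unfold scal; simpl; unfold prod_scal, scal; simpl; unfold mult; simpl.
  f_equal; ring.
Qed.

Lemma is_derive_within_Cmult (D : R -> Prop) (b : R -> R) (f : R -> C) (x db : R) (l : C) :
  D x ->
  is_derive_within (V := R_CompleteNormedModule) D b x db ->
  is_derive_within (V := C_R_CompleteNormedModule) D f x l ->
  is_derive_within (V := C_R_CompleteNormedModule) D
    (fun y => (RtoC (b y) * f y)%C) x (RtoC db * f x + RtoC (b x) * l)%C.
Proof.
  intros Dx Hb Hf.
  pose proof (is_derive_within_scal (V := C_R_CompleteNormedModule)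
    D b f x db l Dx Hb Hf) as H.
  rewrite <- !scal_C.
  refine (is_derive_within_ext (V := C_R_CompleteNormedModule) D _ _ x _ Dx _ H).
  intros y _. apply scal_C.
Qed.

(** Lets Re (th f) inherit the derivatives of f, for the phase th chosen at a maximum of |f|. *)
Lemma is_linear_Re_mult (th : C) :
  is_linear (U := C_R_NormedModule) (V := R_NormedModule) (fun z : C => Re (th * z)%C).
Proof.
  split.
  - intros x y. simpl. unfold plus; simpl. ring.
  - intros k x. rewrite scal_C. unfold scal; simpl. unfold mult; simpl. ring.
  - exists (Cmod th + 1). split; [pose proof (Cmod_ge_0 th); lra|].
    intros x. rewrite <- Cmod_norm. change (norm (Re (th * x)%C)) with (Rabs (Re (th * x)%C)).
    eapply Rle_trans; [apply re_le_Cmod|]. rewrite Cmod_mult.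
    pose proof (Cmod_ge_0 x). nra.
Qed.

Lemma is_linear_RtoC_div (q : R) :
  is_linear (U := R_NormedModule) (V := C_R_NormedModule) (fun x : R => RtoC (x / q)).
Proof.
  split.
  - intros x y. unfold plus; simpl. unfold prod_plus, plus, RtoC; simpl.
    f_equal; [unfold Rdiv; ring|ring].
  - intros k x. rewrite scal_C. unfold scal; simpl. unfold mult; simpl.
    unfold RtoC, Cmult; simpl. f_equal; unfold Rdiv; ring.
  - exists (Rabs (/ q) + 1). split; [pose proof (Rabs_pos (/ q)); lra|].
    intros x. rewrite <- Cmod_norm, Cmod_R. unfold Rdiv. rewrite Rabs_mult.
    change (norm x) with (Rabs x). pose proof (Rabs_pos x). nra.
Qed.

Lemma is_derive_within_R_eps (D : R -> Prop) (f : R -> R) (x l : R) :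
  is_derive_within (V := R_CompleteNormedModule) D f x l -> forall eps, 0 < eps ->
  exists d, 0 < d /\ forall y, D y -> Rabs (y - x) < d ->
    Rabs (f y - f x - (y - x) * l) <= eps * Rabs (y - x).
Proof. exact (is_derive_within_eps D f x l). Qed.

Lemma is_derive_within_interior (a b : R) (f : R -> R) (x l : R) :
  a < x < b ->
  is_derive_within (V := R_CompleteNormedModule) (Icc a b) f x l ->
  derivable_pt_lim f x l.
Proof.
  intros Hx H eps He.
  destruct (is_derive_within_R_eps _ _ _ _ H (eps / 2) ltac:(lra)) as [d [dp Hd]].
  assert (Hm : 0 < Rmin d (Rmin (x - a) (b - x))) by (repeat apply Rmin_pos; lra).
  exists (mkposreal _ Hm). intros k Hk0 Hk; simpl in Hk.
  pose proof (Rmin_l d (Rmin (x - a) (b - x))).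
  pose proof (Rmin_r d (Rmin (x - a) (b - x))).
  pose proof (Rmin_l (x - a) (b - x)). pose proof (Rmin_r (x - a) (b - x)).
  assert (D1 : Icc a b (x + k)) by (apply Rabs_def2 in Hk; unfold Icc; lra).
  specialize (Hd (x + k) D1).
  replace (x + k - x) with k in Hd by ring.
  specialize (Hd ltac:(lra)).
  replace ((f (x + k) - f x) / k - l) with ((f (x + k) - f x - k * l) / k)
    by (field; exact Hk0).
  unfold Rdiv; rewrite Rabs_mult, Rabs_inv.
  pose proof (Rabs_pos_lt k Hk0).
  apply Rmult_lt_reg_r with (Rabs k); [assumption|].
  rewrite Rmult_assoc, Rinv_l by lra. nra.
Qed.

(** A maximum at a would force f' <= 0 there and one at b would force f' >= 0, against the sign
    conditions; so x0 is interior and f' vanishes. If f'' were positive, f' would be positive just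
    to the right of x0 and f would exceed its maximum. *)
Lemma max_second_order (a b : R) (f f1 f2 : R -> R) (x0 : R) :
  a < b -> Icc a b x0 ->
  (forall x, Icc a b x -> is_derive_within (V := R_CompleteNormedModule) (Icc a b) f x (f1 x)) ->
  (forall x, Icc a b x -> is_derive_within (V := R_CompleteNormedModule) (Icc a b) f1 x (f2 x)) ->
  (forall x, Icc a b x -> f x <= f x0) ->
  (x0 = a -> 0 < f1 x0) -> (x0 = b -> f1 x0 < 0) ->
  f1 x0 = 0 /\ f2 x0 <= 0.
Proof.
  intros ab Dx H1 H2 Hmax Ha Hb.
  assert (Hinc : x0 < b -> f1 x0 <= 0).
  { intros Hlt. apply Rnot_lt_le; intros Hp.
    destruct (is_derive_within_R_eps _ _ _ _ (H1 x0 Dx) (f1 x0 / 2) ltac:(lra))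
      as [d [dp Hd]].
    set (k := Rmin (d / 2) (b - x0)).
    assert (0 < k) by (apply Rmin_pos; lra).
    assert (k <= d / 2) by apply Rmin_l. assert (k <= b - x0) by apply Rmin_r.
    assert (D1 : Icc a b (x0 + k)) by (unfold Icc in *; lra).
    specialize (Hd _ D1). specialize (Hmax _ D1).
    replace (x0 + k - x0) with k in Hd by ring.
    rewrite (Rabs_pos_eq k) in Hd by lra. specialize (Hd ltac:(lra)).
    apply Rabs_le_between in Hd. nra. }
  assert (Hdec : a < x0 -> 0 <= f1 x0).
  { intros Hlt. apply Rnot_lt_le; intros Hp.
    destruct (is_derive_within_R_eps _ _ _ _ (H1 x0 Dx) (- f1 x0 / 2) ltac:(lra))
      as [d [dp Hd]].
    set (k := Rmin (d / 2) (x0 - a)).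
    assert (0 < k) by (apply Rmin_pos; lra).
    assert (k <= d / 2) by apply Rmin_l. assert (k <= x0 - a) by apply Rmin_r.
    assert (D1 : Icc a b (x0 - k)) by (unfold Icc in *; lra).
    specialize (Hd _ D1). specialize (Hmax _ D1).
    replace (x0 - k - x0) with (- k) in Hd by ring.
    rewrite Rabs_Ropp, (Rabs_pos_eq k) in Hd by lra. specialize (Hd ltac:(lra)).
    apply Rabs_le_between in Hd. nra. }
  unfold Icc in Dx.
  assert (Hxa : a < x0).
  { destruct (Rle_lt_or_eq_dec a x0 (proj1 Dx)) as [h|h]; [exact h|].
    specialize (Ha (eq_sym h)). assert (Hxb : x0 < b) by lra. specialize (Hinc Hxb). lra. }
  assert (Hxb : x0 < b).
  { destruct (Rle_lt_or_eq_dec x0 b (proj2 Dx)) as [h|h]; [exact h|].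
    specialize (Hb h). specialize (Hdec Hxa). lra. }
  assert (H0 : f1 x0 = 0) by (specialize (Hinc Hxb); specialize (Hdec Hxa); lra).
  split; [exact H0|]. apply Rnot_lt_le; intros Hp.
  destruct (is_derive_within_R_eps _ _ _ _ (H2 x0 Dx) (f2 x0 / 2) ltac:(lra))
    as [d [dp Hd]].
  (* Half of b - x0 keeps the closed segment inside the open interval, where the two-sided
     derivatives of the mean value theorem exist. *)
  set (k := Rmin (d / 2) ((b - x0) / 2)).
  assert (0 < k) by (apply Rmin_pos; lra).
  assert (k <= d / 2) by apply Rmin_l. assert (k <= (b - x0) / 2) by apply Rmin_r.
  destruct (MVT_cor2 f f1 x0 (x0 + k) ltac:(lra)) as [c [Hc1 Hc2]].
  { intros c Hc. apply is_derive_within_interior with a b; [lra|].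
    apply H1. unfold Icc; lra. }
  assert (D1 : Icc a b (x0 + k)) by (unfold Icc; lra).
  specialize (Hmax _ D1).
  assert (Dc : Icc a b c) by (unfold Icc; lra).
  specialize (Hd c Dc). rewrite (Rabs_pos_eq (c - x0)) in Hd by lra.
  specialize (Hd ltac:(lra)). apply Rabs_le_between in Hd.
  rewrite H0 in Hd.
  assert (0 < (c - x0) * f2 x0) by (apply Rmult_lt_0_compat; lra).
  assert (0 < f1 c) by lra.
  assert (0 < f1 c * (x0 + k - x0)) by (apply Rmult_lt_0_compat; lra). lra.
Qed.

(** * Dissipativity of the Fokker-Planck operator *)

(** Retraction of the line onto [a, b]: composing with it turns continuity within the interval into
    two-sided continuity, as the extreme value theorem requires. It returns as a counting function
    in [Qsum_lower_bound_interval]. *)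
Definition clamp (a b x : R) : R := Rmax a (Rmin b x).

Lemma clamp_Icc a b x : a <= b -> Icc a b (clamp a b x).
Proof. unfold Icc, clamp, Rmax, Rmin; intros; repeat destruct Rle_dec; lra. Qed.

Lemma clamp_id a b x : Icc a b x -> clamp a b x = x.
Proof. unfold Icc, clamp, Rmax, Rmin; intros; repeat destruct Rle_dec; lra. Qed.

Lemma clamp_lipschitz a b x y : Rabs (clamp a b y - clamp a b x) <= Rabs (y - x).
Proof.
  unfold clamp, Rmax, Rmin; intros; repeat destruct Rle_dec;
    unfold Rabs; repeat destruct Rcase_abs; lra.
Qed.

Lemma continuous_clamp_comp {U : UniformSpace} (a b : R) (f : R -> U) (x : R) :
  a <= b -> continuous_on (Icc a b) f -> continuous (fun y => f (clamp a b y)) x.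
Proof.
  intros ab Hf P HP.
  destruct (Hf (clamp a b x) (clamp_Icc a b x ab) P HP) as [d Hd].
  exists d. intros y Hy. apply Hd; [|now apply clamp_Icc].
  eapply Rle_lt_trans; [apply clamp_lipschitz|exact Hy].
Qed.

Lemma continuous_on_max (a b : R) (f : R -> R) :
  a <= b -> continuous_on (U := R_UniformSpace) (Icc a b) f ->
  exists x0, Icc a b x0 /\ forall x, Icc a b x -> f x <= f x0.
Proof.
  intros ab Hf.
  destruct (continuity_ab_maj (fun x => f (clamp a b x)) a b ab) as [m [Hm Dm]].
  { intros c _. apply continuity_pt_filterlim.
    exact (continuous_clamp_comp (U := R_UniformSpace) a b f c ab Hf). }
  exists m; split; [exact Dm|]. intros x Dx. specialize (Hm x Dx).
  now rewrite !clamp_id in Hm.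
Qed.

Lemma cont_Cmod_max (a b : R) (f : R -> C) :
  a <= b -> cont (Icc a b) f ->
  exists x0, Icc a b x0 /\ forall x, Icc a b x -> Cmod (f x) <= Cmod (f x0).
Proof.
  intros ab Hf. apply (continuous_on_max a b (fun x => Cmod (f x)) ab).
  intros x Dx. eapply filterlim_comp; [apply (Hf x Dx)|].
  eapply filterlim_ext; [intros z; symmetry; apply Cmod_norm|].
  rewrite Cmod_norm. apply (filterlim_norm (V := C_R_NormedModule)).
Qed.

Section SupNorm.
Variables (a b : R).
Hypothesis ab : a <= b.
Let D := Icc a b.

(** [sup_norm] is the real part of an extended real; since the maximum is attained, the least upper
    bound is finite and that real part is meaningful. *)
Lemma sup_norm_ub (f : R -> C) (x : R) : cont D f -> D x -> Cmod (f x) <= sup_norm D f.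
Proof.
  intros Hf Dx. destruct (cont_Cmod_max a b f ab Hf) as [x0 [D0 H0]].
  unfold sup_norm. rewrite (is_lub_Rbar_unique _ (Finite (Cmod (f x0)))).
  - apply H0, Dx.
  - split.
    + intros r [y [Dy ->]]. apply H0, Dy.
    + intros l Hl. apply Hl. now exists x0.
Qed.

Lemma sup_norm_le (f : R -> C) (c : R) :
  (forall x, D x -> Cmod (f x) <= c) -> sup_norm D f <= c.
Proof.
  intros H. unfold sup_norm.
  destruct (Lub_Rbar_correct (fun r => exists x, D x /\ r = Cmod (f x))) as [H1 H2].
  (* The point a makes the set non-empty and excludes [m_infty]; the bound c excludes [p_infty]. *)
  assert (Da : D a) by (split; lra).
  pose proof (H1 (Cmod (f a)) ltac:(now exists a)) as L1.
  assert (L2 : Rbar_le (Lub_Rbar (fun r => exists x, D x /\ r = Cmod (f x))) c).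
  { apply H2. intros r [x [Dx ->]]. apply H, Dx. }
  destruct (Lub_Rbar _); simpl in *; tauto.
Qed.

Lemma sup_norm_pos (f : R -> C) : cont D f -> 0 <= sup_norm D f.
Proof.
  intros Hf. assert (Da : D a) by (split; lra).
  eapply Rle_trans; [apply Cmod_ge_0|apply (sup_norm_ub f a Hf Da)].
Qed.

End SupNorm.

Lemma is_derive_within_Rplus (D : R -> Prop) (f g : R -> R) (x df dg : R) :
  is_derive_within (V := R_CompleteNormedModule) D f x df ->
  is_derive_within (V := R_CompleteNormedModule) D g x dg ->
  is_derive_within (V := R_CompleteNormedModule) D (fun y => f y + g y) x (df + dg).
Proof. exact (is_derive_within_plus (V := R_CompleteNormedModule) D f g x df dg). Qed.

Lemma is_derive_within_Rminus (D : R -> Prop) (f g : R -> R) (x df dg : R) :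
  is_derive_within (V := R_CompleteNormedModule) D f x df ->
  is_derive_within (V := R_CompleteNormedModule) D g x dg ->
  is_derive_within (V := R_CompleteNormedModule) D (fun y => f y - g y) x (df - dg).
Proof.
  intros Hf Hg. apply is_derive_within_Rplus; [exact Hf|].
  exact (is_derive_within_linear (V := R_CompleteNormedModule) (W := R_CompleteNormedModule)
    opp D g x dg is_linear_opp Hg).
Qed.

Lemma cont_Cmult (D : R -> Prop) (c : R -> R) (g : R -> C) :
  continuous_on (U := R_UniformSpace) D c -> cont D g ->
  cont D (fun x => (RtoC (c x) * g x)%C).
Proof.
  intros Hc Hg x Dx.
  apply (filterlim_ext (fun y => scal (V := C_R_NormedModule) (c y) (g y)));
    [intros; apply scal_C|].
  rewrite <- scal_C.
  eapply (filterlim_comp_2 c g (fun k z => scal (V := C_R_NormedModule) k z));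
    [exact (Hc x Dx)|exact (Hg x Dx)|].
  apply (filterlim_scal (V := C_R_NormedModule)).
Qed.

Lemma cont_Cplus (D : R -> Prop) (g k : R -> C) :
  cont D g -> cont D k -> cont D (fun x => (g x + k x)%C).
Proof.
  intros Hg Hk x Dx.
  eapply (filterlim_comp_2 g k Cplus); [exact (Hg x Dx)|exact (Hk x Dx)|].
  apply (filterlim_plus (V := C_R_NormedModule)).
Qed.

Lemma continuous_on_Rplus (D : R -> Prop) (g k : R -> R) :
  continuous_on (U := R_UniformSpace) D g -> continuous_on (U := R_UniformSpace) D k ->
  continuous_on (U := R_UniformSpace) D (fun x => g x + k x).
Proof.
  intros Hg Hk x Dx.
  eapply (filterlim_comp_2 g k Rplus); [exact (Hg x Dx)|exact (Hk x Dx)|].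
  apply (filterlim_plus (V := R_NormedModule)).
Qed.

Lemma continuous_on_Rscal (D : R -> Prop) (r : R) (g : R -> R) :
  continuous_on (U := R_UniformSpace) D g ->
  continuous_on (U := R_UniformSpace) D (fun x => r * g x).
Proof.
  intros Hg x Dx.
  eapply filterlim_comp; [exact (Hg x Dx)|].
  apply (filterlim_scal_r (V := R_NormedModule) r).
Qed.

Lemma Rminus_def_scal (u v : R) : u + (-1) * v = u - v.
Proof. ring. Qed.

Lemma continuous_on_Rminus (D : R -> Prop) (g k : R -> R) :
  continuous_on (U := R_UniformSpace) D g -> continuous_on (U := R_UniformSpace) D k ->
  continuous_on (U := R_UniformSpace) D (fun x => g x - k x).
Proof.
  intros Hg Hk.
  apply (continuous_on_ext D (fun x => g x + (-1) * k x)); [intros x _; apply Rminus_def_scal|].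
  apply continuous_on_Rplus; [exact Hg|]. now apply continuous_on_Rscal.
Qed.

(** * Expanded form of the operator and the maximum principle *)

Section Operator.
Variables (fA fC A1 A2 C1 C2 : R -> R) (N : nat).
Hypothesis HN : (0 < N)%nat.
Let h := mesh N.
Let D := dom_interval N.
Hypothesis HA1 : forall x, D x -> is_derive_within (V := R_CompleteNormedModule) D fA x (A1 x).
Hypothesis HA2 : forall x, D x -> is_derive_within (V := R_CompleteNormedModule) D A1 x (A2 x).
Hypothesis HC1 : forall x, D x -> is_derive_within (V := R_CompleteNormedModule) D fC x (C1 x).
Hypothesis HC2 : forall x, D x -> is_derive_within (V := R_CompleteNormedModule) D C1 x (C2 x).
Hypothesis CA2 : continuous_on (U := R_UniformSpace) D A2.
Hypothesis CC2 : continuous_on (U := R_UniformSpace) D C2.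

Lemma mesh_pos : 0 < mesh N.
Proof.
  unfold mesh. apply lt_INR in HN; simpl in HN.
  apply Rdiv_lt_0_compat; lra.
Qed.

Lemma dom_interval_lt : - mesh N < 1 + mesh N.
Proof. pose proof mesh_pos. lra. Qed.

Section Fixed.
Variables (f f1 f2 : R -> C).
Hypothesis Hf1 : forall x, D x -> is_derive_within (V := C_R_CompleteNormedModule) D f x (f1 x).
Hypothesis Hf2 : forall x, D x -> is_derive_within (V := C_R_CompleteNormedModule) D f1 x (f2 x).

Let g1 (x : R) : C := (RtoC (A1 x + C1 x) * f x + RtoC (fA x + fC x) * f1 x)%C.

Lemma DC_diff x : D x -> DC N (diff_part fA fC f) x = g1 x.
Proof.
  intros Dx. apply (Derive_within_correct (V := C_R_CompleteNormedModule) (- mesh N) (1 + mesh N));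
    [exact dom_interval_lt|exact Dx|].
  apply (is_derive_within_Cmult D (fun y => fA y + fC y) f); [exact Dx| |now apply Hf1].
  apply is_derive_within_Rplus; auto.
Qed.

Lemma DC_drift x : D x ->
  DC N (drift_part fA fC f) x = (RtoC (A1 x - C1 x) * f x + RtoC (fA x - fC x) * f1 x)%C.
Proof.
  intros Dx. apply (Derive_within_correct (V := C_R_CompleteNormedModule) (- mesh N) (1 + mesh N));
    [exact dom_interval_lt|exact Dx|].
  apply (is_derive_within_Cmult D (fun y => fA y - fC y) f); [exact Dx| |now apply Hf1].
  apply is_derive_within_Rminus; auto.
Qed.

Lemma DC_DC_diff x : D x ->
  DC N (DC N (diff_part fA fC f)) x =
  (RtoC (A2 x + C2 x) * f x + RtoC 2 * RtoC (A1 x + C1 x) * f1 x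
   + RtoC (fA x + fC x) * f2 x)%C.
Proof.
  intros Dx. apply (Derive_within_correct (V := C_R_CompleteNormedModule) (- mesh N) (1 + mesh N));
    [exact dom_interval_lt|exact Dx|].
  (* The inner derivative is known to equal [g1] only on D, which is enough for a derivative within
     D. *)
  apply (is_derive_within_ext (V := C_R_CompleteNormedModule) D g1); [exact Dx| |].
  { intros y Dy; symmetry; now apply DC_diff. }
  replace (RtoC (A2 x + C2 x) * f x + RtoC 2 * RtoC (A1 x + C1 x) * f1 x
   + RtoC (fA x + fC x) * f2 x)%C with
   ((RtoC (A2 x + C2 x) * f x + RtoC (A1 x + C1 x) * f1 x)
    + (RtoC (A1 x + C1 x) * f1 x + RtoC (fA x + fC x) * f2 x))%C.
  2: { replace (RtoC 2) with (RtoC 1 + RtoC 1)%C by (rewrite <- RtoC_plus; f_equal; ring). ring. }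
  apply (is_derive_within_plus (V := C_R_CompleteNormedModule)).
  - apply (is_derive_within_Cmult D (fun y => A1 y + C1 y) f); [exact Dx| |now apply Hf1].
    apply is_derive_within_Rplus; auto.
  - apply (is_derive_within_Cmult D (fun y => fA y + fC y) f1); [exact Dx| |now apply Hf2].
    apply is_derive_within_Rplus; auto.
Qed.

(** Coefficients of the operator in non-divergence form. At an interior maximum the first-order term
    vanishes and the second-order term is non-positive, so only [coef0] can cause growth. *)
Let coef0 (x : R) : R := h * (A2 x + C2 x) - (A1 x - C1 x).
Let coef1 (x : R) : R := 2 * h * (A1 x + C1 x) - (fA x - fC x).
Let coef2 (x : R) : R := h * (fA x + fC x).

Lemma FP_op_expand x : D x ->
  FP_op fA fC N f x = (RtoC (coef0 x) * f x + RtoC (coef1 x) * f1 x + RtoC (coef2 x) * f2 x)%C.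
Proof.
  intros Dx. unfold FP_op. rewrite DC_DC_diff, DC_drift by exact Dx.
  unfold coef0, coef1, coef2, h.
  repeat (rewrite RtoC_plus || rewrite RtoC_minus || rewrite RtoC_mult). ring.
Qed.

Lemma FP_flux_expand x : D x ->
  FP_flux fA fC N f x =
  (RtoC (h * (A1 x + C1 x) - (fA x - fC x)) * f x + RtoC (coef2 x) * f1 x)%C.
Proof.
  intros Dx. unfold FP_flux. rewrite DC_diff by exact Dx.
  unfold g1, drift_part, coef2, h.
  repeat (rewrite RtoC_plus || rewrite RtoC_minus || rewrite RtoC_mult). ring.
Qed.

Lemma cont_FP_op : cont D f2 -> cont D (FP_op fA fC N f).
Proof.
  intros Hf2c.
  assert (Cf : cont D f)
    by exact (is_derive_within_continuous_on (V := C_R_CompleteNormedModule) D f f1 Hf1).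
  assert (Cf1 : cont D f1)
    by exact (is_derive_within_continuous_on (V := C_R_CompleteNormedModule) D f1 f2 Hf2).
  pose proof (is_derive_within_continuous_on (V := R_CompleteNormedModule) D fA A1 HA1).
  pose proof (is_derive_within_continuous_on (V := R_CompleteNormedModule) D A1 A2 HA2).
  pose proof (is_derive_within_continuous_on (V := R_CompleteNormedModule) D fC C1 HC1).
  pose proof (is_derive_within_continuous_on (V := R_CompleteNormedModule) D C1 C2 HC2).
  apply (continuous_on_ext D
    (fun x => (RtoC (coef0 x) * f x + RtoC (coef1 x) * f1 x + RtoC (coef2 x) * f2 x)%C)).
  { intros x Dx; symmetry; now apply FP_op_expand. }
  repeat apply cont_Cplus; apply cont_Cmult; try assumption;
    unfold coef0, coef1, coef2;
    repeat (apply continuous_on_Rminus || apply continuous_on_Rplus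
            || apply continuous_on_Rscal); assumption.
Qed.

Variable w : R.
Hypothesis Hw : forall x, D x -> h * (A2 x + C2 x) - (A1 x - C1 x) <= w.
Hypothesis Hpos : forall x, D x -> 0 < fA x + fC x.
Hypothesis Hl : h * Rabs (A1 (- h) + C1 (- h)) < fA (- h) - fC (- h).
Hypothesis Hr : fA (1 + h) - fC (1 + h) < - (h * Rabs (A1 (1 + h) + C1 (1 + h))).

Lemma Re_RtoC_mult (th z : C) (r : R) : Re (th * (RtoC r * z))%C = r * Re (th * z)%C.
Proof. simpl. ring. Qed.

(* At a maximum point of |f| the function Re(th f), with th the phase that makes
   th f positive there, also has a maximum; the zero-flux condition makes the
   one-sided derivative at an end point point inwards, so the maximum is interior. *)
Lemma FP_op_dissipative (s c : R) :
  0 <= s -> FP_flux fA fC N f (- h) = RtoC 0 -> FP_flux fA fC N f (1 + h) = RtoC 0 ->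
  (forall x, D x -> Cmod (f x - RtoC s * FP_op fA fC N f x)%C <= c) ->
  0 <= 1 - s * w -> forall x, D x -> (1 - s * w) * Cmod (f x) <= c.
Proof.
  intros Hs Fl Fr Hc Hsw.
  pose proof mesh_pos as hp. fold h in hp.
  assert (ab : - h <= 1 + h) by lra.
  assert (Cf : cont D f)
    by exact (is_derive_within_continuous_on (V := C_R_CompleteNormedModule) D f f1 Hf1).
  destruct (cont_Cmod_max (- h) (1 + h) f ab Cf) as [x0 [D0 M0]].
  change (D x0) in D0.
  set (m := Cmod (f x0)) in *.
  assert (Hm0 : 0 <= m) by apply Cmod_ge_0.
  enough (Hm : (1 - s * w) * m <= c).
  { intros x Dx. eapply Rle_trans; [|exact Hm]. apply Rmult_le_compat_l; [exact Hsw|now apply M0]. }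
  destruct (Rle_lt_or_eq_dec 0 m Hm0) as [Hm|Hm].
  2: { rewrite <- Hm, Rmult_0_r. eapply Rle_trans; [apply Cmod_ge_0|exact (Hc x0 D0)]. }
  assert (Hmne : RtoC m <> 0) by (intros E; apply RtoC_inj in E; lra).
  set (th := (Cconj (f x0) / RtoC m)%C).
  assert (Hth : Cmod th = 1).
  { unfold th. rewrite Cmod_div, Cmod_conj, Cmod_R, Rabs_pos_eq by assumption.
    fold m. field. lra. }
  assert (Hthf : (th * f x0)%C = RtoC m).
  { unfold th. replace (Cconj (f x0) / RtoC m * f x0)%C with ((f x0 * Cconj (f x0)) / RtoC m)%C
      by (unfold Cdiv; ring).
    rewrite <- Cmod2_conj. fold m. rewrite RtoC_pow. field. exact Hmne. }
  set (p := fun x => Re (th * f x)%C). set (p1 := fun x => Re (th * f1 x)%C).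
  set (p2 := fun x => Re (th * f2 x)%C).
  assert (Hp0 : p x0 = m) by (unfold p; rewrite Hthf; reflexivity).
  assert (Hle : forall z : C, Re (th * z)%C <= Cmod z).
  { intros z. eapply Rle_trans; [apply Rle_abs|].
    eapply Rle_trans; [apply re_le_Cmod|]. rewrite Cmod_mult, Hth. lra. }
  assert (Hflux : forall x, D x -> FP_flux fA fC N f x = RtoC 0 ->
    (h * (A1 x + C1 x) - (fA x - fC x)) * p x + coef2 x * p1 x = 0).
  { intros x Dx E. rewrite FP_flux_expand in E by exact Dx.
    apply (f_equal (fun z => Re (th * z)%C)) in E.
    rewrite Cmult_plus_distr_l, re_plus, !Re_RtoC_mult, Cmult_0_r in E. exact E. }
  destruct (max_second_order (- h) (1 + h) p p1 p2 x0) as [E1 E2].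
  - lra.
  - exact D0.
  - intros x Dx. exact (is_derive_within_linear (V := C_R_CompleteNormedModule)
      (W := R_CompleteNormedModule) _ D f x _ (is_linear_Re_mult th) (Hf1 x Dx)).
  - intros x Dx. exact (is_derive_within_linear (V := C_R_CompleteNormedModule)
      (W := R_CompleteNormedModule) _ D f1 x _ (is_linear_Re_mult th) (Hf2 x Dx)).
  - intros x Dx. rewrite Hp0. eapply Rle_trans; [apply Hle|now apply M0].
  (* Zero flux says coef2 p' = ((A - C) - h (A' + C')) m, and [Hl] makes the bracket positive: p
     increases away from the left end. The right end is the mirror image with [Hr]. *)
  - intros ->. specialize (Hflux _ D0 Fl). rewrite Hp0 in Hflux.
    pose proof (Hpos _ D0). pose proof (Rle_abs (A1 (- h) + C1 (- h))).
    assert (h * (A1 (- h) + C1 (- h)) <= h * Rabs (A1 (- h) + C1 (- h)))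
      by (apply Rmult_le_compat_l; lra).
    assert (Hc2 : 0 < coef2 (- h)) by (apply Rmult_lt_0_compat; assumption).
    apply Rnot_le_lt; intros Hn.
    assert (coef2 (- h) * p1 (- h) <= 0) by nra.
    assert ((h * (A1 (- h) + C1 (- h)) - (fA (- h) - fC (- h))) * m < 0) by nra.
    lra.
  - intros ->. specialize (Hflux _ D0 Fr). rewrite Hp0 in Hflux.
    pose proof (Hpos _ D0). pose proof (Rle_abs (- (A1 (1 + h) + C1 (1 + h)))) as HA.
    rewrite Rabs_Ropp in HA.
    assert (h * (- (A1 (1 + h) + C1 (1 + h))) <= h * Rabs (A1 (1 + h) + C1 (1 + h)))
      by (apply Rmult_le_compat_l; lra).
    assert (Hc2 : 0 < coef2 (1 + h)) by (apply Rmult_lt_0_compat; assumption).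
    apply Rnot_le_lt; intros Hn.
    assert (0 <= coef2 (1 + h) * p1 (1 + h)) by nra.
    assert (0 < (h * (A1 (1 + h) + C1 (1 + h)) - (fA (1 + h) - fC (1 + h))) * m) by nra.
    lra.
  (* At x0 the real part of th (f - s G f) is at least (1 - s w) m, and it is at most the modulus
     because |th| = 1. *)
  - eapply Rle_trans; [|exact (Hc x0 D0)]. eapply Rle_trans; [|apply Hle].
    rewrite FP_op_expand by exact D0.
    replace (Re (th * (f x0 - RtoC s * (RtoC (coef0 x0) * f x0 + RtoC (coef1 x0) * f1 x0
      + RtoC (coef2 x0) * f2 x0)))%C)
    with (p x0 - s * (coef0 x0 * p x0 + coef1 x0 * p1 x0 + coef2 x0 * p2 x0))
      by (unfold p, p1, p2; simpl; ring).
    rewrite Hp0, E1.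
    assert (Hc2 : 0 < coef2 x0) by (apply Rmult_lt_0_compat; [exact hp|exact (Hpos _ D0)]).
    assert (coef0 x0 * m <= w * m) by (apply Rmult_le_compat_r; [lra|exact (Hw _ D0)]).
    assert (coef2 x0 * p2 x0 <= 0) by nra.
    nra.
Qed.

End Fixed.
End Operator.

(** * Local boundedness of C0-semigroups *)

(** Pointwise form of [sup_norm D f <= c], which avoids the question whether the least upper bound
    is finite. *)
Definition bounded_by (D : R -> Prop) (c : R) (f : R -> C) : Prop :=
  forall x, D x -> Cmod (f x) <= c.

Lemma Cmod_le_Rabs (z : C) : Cmod z <= Rabs (fst z) + Rabs (snd z).
Proof.
  replace z with (RtoC (fst z) + Ci * RtoC (snd z))%C at 1
    by (destruct z; unfold Cplus, Cmult; simpl; f_equal; ring).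
  eapply Rle_trans; [apply Cmod_triangle|].
  rewrite Cmod_mult, Cmod_Ci, !Cmod_R. lra.
Qed.

(** The uniform structure of C is that of a product, so its balls are squares; passing to [Cmod]
    costs the factor 2 in eps / 2. *)
Lemma cont_eps (D : R -> Prop) (f : R -> C) :
  cont D f <->
  forall x, D x -> forall eps, 0 < eps ->
  exists d, 0 < d /\ forall y, D y -> Rabs (y - x) < d -> Cmod (f y - f x)%C < eps.
Proof.
  split.
  - intros Hf x Dx eps He.
    apply (within_locally_eps D x (fun y => Cmod (f y - f x)%C < eps)).
    apply (Hf x Dx (fun z => Cmod (z - f x)%C < eps)).
    assert (He2 : 0 < eps / 2) by lra.
    exists (mkposreal _ He2). intros z [Hz1 Hz2].
    eapply Rle_lt_trans; [apply Cmod_le_Rabs|].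
    change (Rabs (fst z - fst (f x)) < eps / 2) in Hz1.
    change (Rabs (snd z - snd (f x)) < eps / 2) in Hz2.
    simpl. unfold Rminus in Hz1, Hz2. lra.
  - intros H x Dx P [e HP].
    destruct (H x Dx e (cond_pos e)) as [d [dp Hd]].
    exists (mkposreal d dp). intros y Hy Dy. apply HP.
    specialize (Hd y Dy Hy).
    split.
    + eapply Rle_lt_trans; [apply (re_le_Cmod (f y - f x)%C)|exact Hd].
    + eapply Rle_lt_trans; [|exact Hd].
      eapply Rle_trans; [apply Rmax_r|apply (Rmax_Cmod (f y - f x)%C)].
Qed.

Lemma cont_lincomb (D : R -> Prop) (al be : C) (f g : R -> C) :
  cont D f -> cont D g -> cont D (fun x => (al * f x + be * g x)%C).
Proof.
  intros Hf Hg. apply cont_eps. intros x Dx eps He.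
  (* The summand 1 keeps K positive and leaves the slack eps / K that makes the final inequality
     strict. *)
  set (K := Cmod al + Cmod be + 1).
  pose proof (Cmod_ge_0 al). pose proof (Cmod_ge_0 be).
  assert (HK : 0 < K) by (unfold K; lra).
  assert (He' : 0 < eps / K) by now apply Rdiv_lt_0_compat.
  destruct (proj1 (cont_eps D f) Hf x Dx _ He') as [d1 [d1p H1]].
  destruct (proj1 (cont_eps D g) Hg x Dx _ He') as [d2 [d2p H2]].
  exists (Rmin d1 d2); split; [now apply Rmin_pos|].
  intros y Dy Hy.
  specialize (H1 y Dy (Rlt_le_trans _ _ _ Hy (Rmin_l _ _))).
  specialize (H2 y Dy (Rlt_le_trans _ _ _ Hy (Rmin_r _ _))).
  replace (al * f y + be * g y - (al * f x + be * g x))%C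
    with (al * (f y - f x) + be * (g y - g x))%C by ring.
  eapply Rle_lt_trans; [apply Cmod_triangle|]. rewrite !Cmod_mult.
  assert (E : eps = Cmod al * (eps / K) + Cmod be * (eps / K) + eps / K)
    by (unfold K in *; field; lra).
  rewrite E.
  assert (Cmod al * Cmod (f y - f x) <= Cmod al * (eps / K)) by (apply Rmult_le_compat_l; lra).
  assert (Cmod be * Cmod (g y - g x) <= Cmod be * (eps / K)) by (apply Rmult_le_compat_l; lra).
  lra.
Qed.

Lemma cont_Cminus (D : R -> Prop) (f g : R -> C) :
  cont D f -> cont D g -> cont D (fun x => (f x - g x)%C).
Proof.
  intros Hf Hg.
  replace (fun x => (f x - g x)%C)
    with (fun x => (RtoC 1 * f x + RtoC (- (1)) * g x)%C).
  - now apply cont_lincomb.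
  - extensionality x. rewrite RtoC_opp. ring.
Qed.

(** Completeness of the space of continuous functions, in the form used by a nested-ball argument:
    the limit lies in all the balls of radius 2 r n. *)
Lemma cont_nested_limit (D : R -> Prop) (f : nat -> R -> C) (r : nat -> R) :
  (forall n, cont D (f n)) ->
  (forall n, 0 < r n) -> (forall n, r (S n) <= r n / 2) ->
  (forall n, bounded_by D (r n / 2) (fun x => (f (S n) x - f n x)%C)) ->
  exists g, cont D g /\ forall n, bounded_by D (2 * r n) (fun x => (g x - f n x)%C).
Proof.
  intros Hf Hr Hr2 Hd.
  (* Since r n / 2 <= r n - r (n + 1), the increments telescope. *)
  assert (Hk : forall n k x, D x -> Cmod (f (n + k)%nat x - f n x)%C <= r n - r (n + k)%nat).
  { intros n k x Dx. induction k as [|k IH].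
    - rewrite Nat.add_0_r. replace (f n x - f n x)%C with (RtoC 0) by ring. rewrite Cmod_0. lra.
    - rewrite Nat.add_succ_r.
      replace (f (S (n + k)) x - f n x)%C
        with ((f (S (n + k)) x - f (n + k)%nat x) + (f (n + k)%nat x - f n x))%C by ring.
      eapply Rle_trans; [apply Cmod_triangle|].
      specialize (Hd (n + k)%nat x Dx). specialize (Hr2 (n + k)%nat). lra. }
  assert (Hlim : forall eps, 0 < eps -> exists n, r n < eps).
  { intros eps He.
    assert (Hb : forall n, r n <= r 0%nat * (1 / 2) ^ n).
    { induction n as [|n IH]; simpl; [lra|]. specialize (Hr2 n). lra. }
    pose proof (Hr 0%nat) as H0.
    destruct (pow_lt_1_zero (1 / 2) ltac:(rewrite Rabs_pos_eq; lra) (eps / r 0%nat)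
      ltac:(now apply Rdiv_lt_0_compat)) as [n Hn].
    exists n. specialize (Hn n (le_n n)). specialize (Hb n).
    rewrite Rabs_pos_eq in Hn by (apply pow_le; lra).
    eapply Rle_lt_trans; [exact Hb|].
    replace eps with (r 0%nat * (eps / r 0%nat)) by (field; lra).
    now apply Rmult_lt_compat_l. }
  (* Used once for [Re] and once for [Im]; adding the two errors gives the radius 2 r n. *)
  assert (Hcomp : forall (pr : C -> R), (forall z w, pr z - pr w = pr (z - w)%C) ->
    (forall z, Rabs (pr z) <= Cmod z) -> forall x, D x ->
    exists l, forall n, Rabs (l - pr (f n x)) <= r n).
  { intros pr Hpr Hle x Dx.
    assert (Hpk : forall n k, Rabs (pr (f (n + k)%nat x) - pr (f n x)) <= r n).
    { intros n k. rewrite Hpr. eapply Rle_trans; [apply Hle|].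
      eapply Rle_trans; [apply Hk, Dx|]. specialize (Hr (n + k)%nat). lra. }
    assert (HC : ex_lim_seq_cauchy (fun n => pr (f n x))).
    { intros eps. destruct (Hlim (eps / 2)) as [n0 Hn0]; [destruct eps; simpl; lra|].
      exists n0. intros n m Hn Hm.
      pose proof (Hpk n0 (n - n0)%nat) as E1. pose proof (Hpk n0 (m - n0)%nat) as E2.
      replace (n0 + (n - n0))%nat with n in E1 by lia.
      replace (n0 + (m - n0))%nat with m in E2 by lia.
      apply Rabs_le_between in E1. apply Rabs_le_between in E2.
      apply Rabs_def1; lra. }
    destruct (proj2 (ex_lim_seq_cauchy_corr _) HC) as [l Hl].
    exists l. intros n.
    apply Rabs_le_between'.
    split.
    - apply (is_lim_seq_le_loc (fun _ => pr (f n x) - r n)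
        (fun m => pr (f m x)) (pr (f n x) - r n) l);
        [|apply is_lim_seq_const|exact Hl].
      exists n. intros m Hm. specialize (Hpk n (m - n)%nat).
      replace (n + (m - n))%nat with m in Hpk by lia.
      apply Rabs_le_between in Hpk. lra.
    - apply (is_lim_seq_le_loc (fun m => pr (f m x))
        (fun _ => pr (f n x) + r n) l (pr (f n x) + r n));
        [|exact Hl|apply is_lim_seq_const].
      exists n. intros m Hm. specialize (Hpk n (m - n)%nat).
      replace (n + (m - n))%nat with m in Hpk by lia.
      apply Rabs_le_between in Hpk. lra. }
  assert (Hpt : forall x, exists z : C, D x -> forall n, Cmod (z - f n x)%C <= 2 * r n).
  { intros x. destruct (classic (D x)) as [Dx|Dx]; [|exists (RtoC 0); tauto].
    destruct (Hcomp Re (fun z w => eq_refl) re_le_Cmod x Dx) as [u Hu].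
    destruct (Hcomp Im (fun z w => eq_refl)) with (x := x) as [v Hv]; [|exact Dx|].
    { intros z. eapply Rle_trans; [apply Rmax_r|apply (Rmax_Cmod z)]. }
    exists (u, v). intros _ n. eapply Rle_trans; [apply Cmod_le_Rabs|]. simpl.
    specialize (Hu n). specialize (Hv n). unfold Rminus in Hu, Hv.
    unfold Re in Hu; unfold Im in Hv. lra. }
  apply functional_choice in Hpt. destruct Hpt as [g Hg].
  exists g. split; [|intros n x Dx; now apply Hg].
  apply cont_eps. intros x Dx eps He.
  (* The two errors 2 r n together stay below eps / 2. *)
  destruct (Hlim (eps / 8) ltac:(lra)) as [n Hn].
  destruct (proj1 (cont_eps D (f n)) (Hf n) x Dx (eps / 2) ltac:(lra)) as [d [dp H]].
  exists d; split; [exact dp|]. intros y Dy Hy.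
  specialize (H y Dy Hy). pose proof (Hg x Dx n). pose proof (Hg y Dy n).
  replace (g y - g x)%C with ((g y - f n y) + (- (g x - f n x)) + (f n y - f n x))%C by ring.
  eapply Rle_lt_trans; [apply Cmod_triangle|].
  eapply Rle_lt_trans; [apply Rplus_le_compat_r, Cmod_triangle|].
  rewrite Cmod_opp. lra.
Qed.

Section Semigroup.
Variables (a b : R) (T : R -> (R -> C) -> R -> C).
Hypothesis ab : a <= b.
Let D := Icc a b.
Hypothesis HT : C0_semigroup D T.

Lemma semigroup_bounded t : 0 <= t ->
  exists M, 0 <= M /\ forall f c, cont D f -> bounded_by D c f -> bounded_by D (M * c) (T t f).
Proof.
  intros Ht. destruct (sg_bounded _ _ HT t Ht) as [M HM].
  (* The constant in [sg_bounded] is not assumed non-negative. *)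
  exists (Rmax M 0). split; [apply Rmax_r|]. intros f c Hf Hc x Dx.
  eapply Rle_trans; [apply (sup_norm_ub a b ab _ x (sg_cont _ _ HT t f Ht Hf) Dx)|].
  eapply Rle_trans; [apply HM, Hf|].
  pose proof (sup_norm_le a b ab f c Hc). pose proof (sup_norm_pos a b ab f Hf).
  eapply Rle_trans; [apply Rmult_le_compat_r; [assumption|apply (Rmax_l M 0)]|].
  apply Rmult_le_compat_l; [apply Rmax_r|assumption].
Qed.

Lemma at_right_sup_norm_eps (F : R -> R -> C) :
  (forall s, 0 < s -> cont D (F s)) ->
  filterlim (fun t => sup_norm D (F t)) (at_right 0) (locally 0) ->
  forall eps, 0 < eps ->
  exists d, 0 < d /\ forall s, 0 < s < d -> bounded_by D eps (F s).
Proof.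
  intros HF H eps He.
  destruct (H (fun z => Rabs z < eps)) as [d Hd].
  { exists (mkposreal eps He). intros z Hz.
    unfold ball in Hz; simpl in Hz. unfold AbsRing_ball, abs, minus, plus, opp in Hz; simpl in Hz.
    now rewrite Ropp_0, Rplus_0_r in Hz. }
  exists d; split; [apply cond_pos|]. intros s [Hs1 Hs2] x Dx.
  assert (Hb : ball 0 d s).
  { unfold ball; simpl. unfold AbsRing_ball, abs, minus, plus, opp; simpl.
    rewrite Ropp_0, Rplus_0_r, Rabs_pos_eq; lra. }
  specialize (Hd s Hb Hs1). cbv beta in Hd.
  eapply Rle_trans; [apply (sup_norm_ub a b ab (F s) x (HF s Hs1) Dx)|].
  apply Rabs_def2 in Hd. fold D. lra.
Qed.

Lemma semigroup_strong f eps : cont D f -> 0 < eps ->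
  exists d, 0 < d /\ forall s, 0 <= s < d -> bounded_by D eps (fun x => (T s f x - f x)%C).
Proof.
  intros Hf He.
  destruct (at_right_sup_norm_eps (fun s x => (T s f x - f x)%C)) with (eps := eps)
    as [d [dp Hd]].
  - intros s Hs. apply cont_Cminus; [|exact Hf]. apply (sg_cont _ _ HT); [lra|exact Hf].
  - apply (sg_strong _ _ HT f Hf).
  - exact He.
  - exists d; split; [exact dp|]. intros s [Hs0 Hs1].
    destruct (Rle_lt_or_eq_dec 0 s Hs0) as [Hs|<-]; [now apply Hd|].
    intros x Dx. rewrite (sg_zero _ _ HT f Hf x Dx).
    replace (f x - f x)%C with (RtoC 0) by ring. rewrite Cmod_0. lra.
Qed.

Lemma semigroup_lincomb t (al be : C) f g x : 0 <= t -> cont D f -> cont D g -> D x ->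
  T t (fun y => (al * f y + be * g y)%C) x = (al * T t f x + be * T t g x)%C.
Proof. intros. now apply (sg_linear _ _ HT). Qed.

Lemma semigroup_minus t f g x : 0 <= t -> cont D f -> cont D g -> D x ->
  T t (fun y => (f y - g y)%C) x = (T t f x - T t g x)%C.
Proof.
  intros Ht Hf Hg Dx.
  replace (fun y => (f y - g y)%C) with (fun y => (RtoC 1 * f y + RtoC (- (1)) * g y)%C).
  - rewrite semigroup_lincomb by assumption. rewrite RtoC_opp. ring.
  - extensionality y. rewrite RtoC_opp. ring.
Qed.

(** If this holds for every n, the orbit of f is unbounded near time 0, which strong continuity
    forbids. *)
Definition blows_up (n : nat) (f : R -> C) : Prop :=
  exists t x, 0 <= t <= / INR (S n) /\ D x /\ INR n <= Cmod (T t f x).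

(* One step of the gliding-hump proof of the uniform boundedness principle: the
   hypothesis is the negation of [semigroup_locally_bounded], and inside every ball
   it yields a smaller one on which [n] is reached within time [1 / (n + 1)]. *)
Lemma nested_ball_step :
  (forall d M, 0 < d -> 0 <= M -> exists t f c, 0 <= t <= d /\ cont D f /\
     bounded_by D c f /\ exists x, D x /\ M * c < Cmod (T t f x)) ->
  forall n f r, cont D f -> 0 < r ->
  exists f' r', cont D f' /\ 0 < r' /\ r' <= r / 2 /\
    bounded_by D (r / 2) (fun x => (f' x - f x)%C) /\
    forall g, cont D g -> bounded_by D (2 * r') (fun x => (g x - f' x)%C) -> blows_up n g.
Proof.
  intros H n f r Hf Hr.
  assert (Hn : 0 < INR (S n)) by (apply lt_0_INR; lia).
  (* Chosen so that the multiple l = r / (2 c) of k has size at most r / 2 and an image of modulus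
     more than l K c = n + 1. *)
  set (K := 2 * INR (S n) / r).
  assert (HK : 0 <= K).
  { apply Rlt_le, Rdiv_lt_0_compat; lra. }
  destruct (H (/ INR (S n)) K (Rinv_0_lt_compat _ Hn) HK)
    as [t [k [c [Ht [Hk [Hc [x [Dx Hx]]]]]]]].
  destruct (semigroup_bounded t (proj1 Ht)) as [M [HM0 HM]].
  assert (Hc0 : 0 < c).
  { apply Rnot_le_lt; intros Hle.
    assert (c = 0) by (pose proof (Rle_trans _ _ _ (Cmod_ge_0 _) (Hc x Dx)); lra).
    subst c. specialize (HM k 0 Hk Hc x Dx). lra. }
  set (l := r / (2 * c)).
  assert (Hl : 0 < l) by (apply Rdiv_lt_0_compat; lra).
  assert (Hbig : INR (S n) < l * Cmod (T t k x)).
  { replace (INR (S n)) with (l * (K * c)) by (unfold l, K; field; lra).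
    now apply Rmult_lt_compat_l. }
  (* The images of f + l k and f - l k differ by 2 l T t k, of modulus more than 2 (n + 1), so one
     of them has modulus at least n + 1. *)
  assert (Hsign : exists s : R, Rabs s = 1 /\
    INR (S n) <= Cmod (T t (fun y => (RtoC 1 * f y + RtoC (s * l) * k y)%C) x)).
  { apply NNPP; intros Hno.
    assert (Hs : forall s, Rabs s = 1 ->
      Cmod (T t f x + RtoC (s * l) * T t k x)%C < INR (S n)).
    { intros s Hs. apply Rnot_le_lt; intros Hle. apply Hno. exists s. split; [exact Hs|].
      rewrite semigroup_lincomb by tauto. now rewrite Cmult_1_l. }
    pose proof (Hs 1 Rabs_R1) as H1.
    pose proof (Hs (- (1)) ltac:(rewrite Rabs_Ropp; apply Rabs_R1)) as H2.
    assert (E : Cmod (RtoC (2 * l) * T t k x)%C < 2 * INR (S n)).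
    { replace (RtoC (2 * l) * T t k x)%C
        with ((T t f x + RtoC (1 * l) * T t k x) + - (T t f x + RtoC (- (1) * l) * T t k x))%C
        by (rewrite !RtoC_mult, RtoC_opp, (RtoC_plus 1 1 : RtoC 2 = _); ring).
      eapply Rle_lt_trans; [apply Cmod_triangle|]. rewrite Cmod_opp. lra. }
    rewrite Cmod_mult, Cmod_R, Rabs_pos_eq in E by lra. lra. }
  destruct Hsign as [s [Hs Hbs]].
  set (f' := fun y => (RtoC 1 * f y + RtoC (s * l) * k y)%C) in *.
  assert (Hf' : cont D f') by now apply cont_lincomb.
  (* Within distance 2 r' <= 1 / (M + 1) of f' the image moves by at most M / (M + 1) <= 1, so n + 1
     drops at most to n. *)
  exists f', (Rmin (r / 2) (/ (2 * (M + 1)))).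
  assert (HM1 : 0 < / (2 * (M + 1))) by (apply Rinv_0_lt_compat; lra).
  split; [exact Hf'|]. split; [apply Rmin_pos; lra|]. split; [apply Rmin_l|]. split.
  - intros y Dy. unfold f'.
    replace (RtoC 1 * f y + RtoC (s * l) * k y - f y)%C with (RtoC (s * l) * k y)%C by ring.
    rewrite Cmod_mult, Cmod_R, Rabs_mult, Hs, Rmult_1_l, Rabs_pos_eq by lra.
    replace (r / 2) with (l * c) by (unfold l; field; lra).
    apply Rmult_le_compat_l; [lra|now apply Hc].
  - intros g Hg Hgf. exists t, x. split; [exact Ht|]. split; [exact Dx|].
    assert (Hgf2 : bounded_by D (/ (M + 1)) (fun x => (g x - f' x)%C)).
    { intros y Dy. eapply Rle_trans; [apply (Hgf y Dy)|].
      replace (/ (M + 1)) with (2 * / (2 * (M + 1))) by (field; lra).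
      apply Rmult_le_compat_l; [lra|apply Rmin_r]. }
    specialize (HM _ _ (cont_Cminus D g f' Hg Hf') Hgf2 x Dx).
    rewrite semigroup_minus in HM by tauto.
    assert (HM2 : M * / (M + 1) <= 1).
    { apply Rmult_le_reg_r with (M + 1); [lra|]. rewrite Rmult_assoc, Rinv_l; lra. }
    assert (E : Cmod (T t f' x) <= Cmod (T t g x) + Cmod (T t g x - T t f' x)%C).
    { replace (T t f' x) with (T t g x + - (T t g x - T t f' x))%C at 1 by ring.
      eapply Rle_trans; [apply Cmod_triangle|]. rewrite Cmod_opp. lra. }
    rewrite S_INR in Hbs. lra.
Qed.

(** If no such bound existed, iterating [nested_ball_step] would produce a single g that blows up
    for every n. *)
Lemma semigroup_locally_bounded :
  exists d M, 0 < d /\ 0 <= M /\ forall t f c, 0 <= t <= d -> cont D f ->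
    bounded_by D c f -> bounded_by D (M * c) (T t f).
Proof.
  apply NNPP; intros Hno.
  assert (H : forall d M, 0 < d -> 0 <= M -> exists t f c, 0 <= t <= d /\ cont D f /\
     bounded_by D c f /\ exists x, D x /\ M * c < Cmod (T t f x)).
  { intros d M Hd HM. apply NNPP; intros Hn. apply Hno. exists d, M.
    split; [exact Hd|]. split; [exact HM|]. intros t f c Ht Hf Hc x Dx.
    apply Rnot_lt_le; intros Hlt. apply Hn. exists t, f, c. eauto 6. }
  pose proof (nested_ball_step H) as Hstep.
  (* The conditions on f and r are moved behind the existential, so that choice yields a total
     function to iterate. *)
  assert (Hstep2 : forall p : nat * ((R -> C) * R), exists q : (R -> C) * R,
    cont D (fst (snd p)) -> 0 < snd (snd p) ->
    cont D (fst q) /\ 0 < snd q /\ snd q <= snd (snd p) / 2 /\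
    bounded_by D (snd (snd p) / 2) (fun x => (fst q x - fst (snd p) x)%C) /\
    forall g, cont D g -> bounded_by D (2 * snd q) (fun x => (g x - fst q x)%C) ->
      blows_up (fst p) g).
  { intros [n [f r]]; simpl. destruct (classic (cont D f /\ 0 < r)) as [[Hf Hr]|Hc].
    - destruct (Hstep n f r Hf Hr) as [f' [r' Hq]]. exists (f', r'). intros _ _. exact Hq.
    - exists (f, r). intros Hf Hr. exfalso; tauto. }
  apply functional_choice in Hstep2. destruct Hstep2 as [F HF].
  set (q := fix q (n : nat) : (R -> C) * R :=
    match n with O => (fun _ => RtoC 0, 1) | S m => F (m, q m) end).
  assert (Hq : forall n, cont D (fst (q n)) /\ 0 < snd (q n)).
  { induction n as [|n [IH1 IH2]].
    - split; [|simpl; lra]. apply continuous_on_forall; intros; apply continuous_const.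
    - destruct (HF (n, q n) IH1 IH2) as [G1 [G2 _]]. split; assumption. }
  assert (Hq2 : forall n, snd (q (S n)) <= snd (q n) / 2 /\
    bounded_by D (snd (q n) / 2) (fun x => (fst (q (S n)) x - fst (q n) x)%C) /\
    forall g, cont D g ->
      bounded_by D (2 * snd (q (S n))) (fun x => (g x - fst (q (S n)) x)%C) ->
      blows_up n g).
  { intros n. destruct (Hq n) as [G1 G2].
    destruct (HF (n, q n) G1 G2) as [_ [_ Hrest]]. exact Hrest. }
  destruct (cont_nested_limit D (fun n => fst (q n)) (fun n => snd (q n))) as [g [Hg Hgq]].
  - intros n; apply Hq.
  - intros n; apply Hq.
  - intros n; apply Hq2.
  - intros n; apply Hq2.
  - assert (Hbl : forall n, blows_up n g).
    { intros n. destruct (Hq2 n) as [_ [_ G]]. apply G; [exact Hg|apply (Hgq (S n))]. }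
    destruct (semigroup_strong g 1 Hg Rlt_0_1) as [d [dp Hd]].
    destruct (cont_Cmod_max a b g ab Hg) as [x0 [_ Hx0]].
    (* Now n + 1 > sup |g| + 1 + 1 / d, so at index n + 1 the orbit exceeds sup |g| + 1 before time
       d. *)
    destruct (nfloor_ex (Cmod (g x0) + 1 + / d)) as [n [_ Hn]].
    { pose proof (Cmod_ge_0 (g x0)). pose proof (Rinv_0_lt_compat d dp). lra. }
    pose proof (Rinv_0_lt_compat d dp) as Hdi. pose proof (Cmod_ge_0 (g x0)) as Hg0.
    destruct (Hbl (S n)) as [t [x [[Ht0 Ht] [Dx Hx]]]].
    assert (Htd : t < d).
    { eapply Rle_lt_trans; [exact Ht|]. rewrite <- (Rinv_inv d).
      apply Rinv_lt_contravar.
      - apply Rmult_lt_0_compat; [exact Hdi|apply lt_0_INR; lia].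
      - rewrite !S_INR. lra. }
    specialize (Hd t (conj Ht0 Htd) x Dx). specialize (Hx0 x Dx).
    assert (E : Cmod (T t g x) <= Cmod (T t g x - g x)%C + Cmod (g x)).
    { replace (T t g x) with ((T t g x - g x) + g x)%C at 1 by ring. apply Cmod_triangle. }
    rewrite S_INR in Hx. lra.
Qed.

(** The semigroup law multiplies the local constants over finitely many steps of length d. *)
Lemma semigroup_bounded_on t0 :
  exists M, 0 <= M /\ forall t f c, 0 <= t <= t0 -> cont D f ->
    bounded_by D c f -> bounded_by D (M * c) (T t f).
Proof.
  destruct semigroup_locally_bounded as [d [M [dp [HM H]]]].
  assert (Hn : forall n : nat, exists M', 0 <= M' /\ forall t f c, 0 <= t <= INR n * d ->
    cont D f -> bounded_by D c f -> bounded_by D (M' * c) (T t f)).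
  { induction n as [|n [M' [HM' IH]]].
    - exists M. split; [exact HM|]. intros t f c Ht. apply H. simpl in Ht. lra.
    - exists (Rmax M (M' * M)). split; [eapply Rle_trans; [exact HM|apply Rmax_l]|].
      intros t f c Ht Hf Hc x Dx.
      assert (Hc0 : 0 <= c) by (eapply Rle_trans; [apply Cmod_ge_0|exact (Hc x Dx)]).
      destruct (Rle_dec t d) as [Htd|Htd].
      + eapply Rle_trans; [apply (H t f c ltac:(lra) Hf Hc x Dx)|].
        apply Rmult_le_compat_r; [exact Hc0|apply Rmax_l].
      + rewrite S_INR in Ht. replace t with ((t - d) + d) by ring.
        rewrite (sg_add _ _ HT (t - d) d f) by (assumption || lra).
        eapply Rle_trans; [apply (IH (t - d) (T d f) (M * c))|].
        * split; lra.
        * apply (sg_cont _ _ HT); [lra|exact Hf].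
        * apply (H d f c ltac:(lra) Hf Hc).
        * exact Dx.
        * rewrite <- Rmult_assoc. apply Rmult_le_compat_r; [exact Hc0|apply Rmax_r]. }
  destruct (nfloor_ex (Rmax 0 (t0 / d)) (Rmax_l _ _)) as [n [_ Hn2]].
  destruct (Hn (S n)) as [M' [HM' HH]]. exists M'. split; [exact HM'|].
  intros t f c Ht. apply HH. split; [lra|]. rewrite S_INR.
  pose proof (Rmax_r 0 (t0 / d)).
  apply Rle_trans with (t0 / d * d); [replace (t0 / d * d) with t0 by (field; lra); lra|].
  apply Rmult_le_compat_r; lra.
Qed.

(** The difference is T (t - s) applied to T s f - f, so strong continuity at 0 suffices once T (t -
    s) is bounded uniformly in s. *)
Lemma semigroup_left_continuous t f eps : 0 < t -> cont D f -> 0 < eps ->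
  exists d, 0 < d /\ forall s, 0 <= s <= t -> s < d ->
    bounded_by D eps (fun x => (T t f x - T (t - s) f x)%C).
Proof.
  intros Ht Hf He. destruct (semigroup_bounded_on t) as [M [HM H]].
  assert (He' : 0 < eps / (M + 1)) by (apply Rdiv_lt_0_compat; lra).
  destruct (semigroup_strong f (eps / (M + 1)) Hf He') as [d [dp Hd]].
  exists d; split; [exact dp|]. intros s Hs Hsd x Dx.
  assert (Cs : cont D (T s f)) by (apply (sg_cont _ _ HT); [lra|exact Hf]).
  replace (T t f x) with (T (t - s) (T s f) x).
  2: { rewrite <- (sg_add _ _ HT (t - s) s f) by (assumption || lra). f_equal; ring. }
  rewrite <- semigroup_minus by (assumption || lra).
  eapply Rle_trans.
  - apply (H (t - s) _ (eps / (M + 1)) ltac:(lra)); [|apply Hd; lra|exact Dx].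
    now apply cont_Cminus.
  - replace eps with ((M + 1) * (eps / (M + 1))) at 2 by (field; lra).
    apply Rmult_le_compat_r; lra.
Qed.

End Semigroup.

(** * Growth of dissipative semigroups *)

(* Only a right-hand differential inequality is available, so Gronwall's inequality
   is obtained from a supremum argument; the slack [eps * t] absorbs the error terms. *)
Lemma gronwall_induction (P : R -> R -> Prop) (w c0 : R) :
  0 <= w -> 0 <= c0 ->
  (forall t c c', P t c -> c <= c' -> P t c') ->
  P 0 c0 ->
  (forall t c eps, 0 <= t -> 0 <= c -> P t c -> 0 < eps ->
     exists d, 0 < d /\ forall s, 0 < s < d -> P (t + s) ((1 + w * s) * c + eps * s)) ->
  (forall t c, 0 < t -> 0 <= c -> (forall s, 0 <= s < t -> P s c) -> P t c) ->
  (forall t c, (forall eps, 0 < eps -> P t (c + eps)) -> P t c) ->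
  forall t, 0 <= t -> P t (exp (w * t) * c0).
Proof.
  intros Hw Hc0 Hmono Hinit Hright Hleft Hclosed t Ht.
  assert (Hexp : forall s, 0 <= s -> 1 <= exp (w * s)).
  { intros s Hs. rewrite <- exp_0.
    destruct (Rle_lt_or_eq_dec 0 (w * s)) as [h|h]; [now apply Rmult_le_pos| |].
    - apply Rlt_le, exp_increasing, h.
    - rewrite <- h. lra. }
  enough (Heps : forall eps, 0 < eps -> P t (exp (w * t) * (c0 + eps * t))).
  { apply Hclosed. intros e He.
    assert (Hd : 0 < exp (w * t) * (t + 1)).
    { apply Rmult_lt_0_compat; [apply exp_pos|lra]. }
    (* With this slack the excess is e t / (t + 1), at most e. *)
    apply Hmono with (1 := Heps (e / (exp (w * t) * (t + 1))) ltac:(now apply Rdiv_lt_0_compat)).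
    pose proof (exp_pos (w * t)) as Hep.
    replace (exp (w * t) * (c0 + e / (exp (w * t) * (t + 1)) * t))
      with (exp (w * t) * c0 + e * (t / (t + 1))) by (field; lra).
    assert (t / (t + 1) <= 1).
    { apply Rmult_le_reg_r with (t + 1); [lra|]. unfold Rdiv. rewrite Rmult_assoc, Rinv_l; lra. }
    nra. }
  intros eps He. set (g := fun s => exp (w * s) * (c0 + eps * s)).
  assert (Hg0 : forall s, 0 <= s -> 0 <= g s).
  { intros s Hs. apply Rmult_le_pos; [apply Rlt_le, exp_pos|]. nra. }
  (* g dominates every step allowed by [Hright]: 1 + w d <= exp (w d) takes care of the growth, and
     the increment of eps s, multiplied by an exponential that is at least 1, pays for eps d. *)
  assert (Hstep : forall s d, 0 <= s -> 0 <= d -> (1 + w * d) * g s + eps * d <= g (s + d)).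
  { intros s d Hs Hd. unfold g.
    replace (exp (w * (s + d))) with (exp (w * s) * exp (w * d))
      by (rewrite <- exp_plus; f_equal; ring).
    pose proof (Hexp s Hs) as H1. pose proof (Hexp d Hd) as H2.
    pose proof (exp_ineq1_le (w * d)) as H3.
    assert (H4 : 0 <= c0 + eps * s) by nra.
    assert (H5 : (1 + w * d) * (exp (w * s) * (c0 + eps * s)) <=
      exp (w * d) * (exp (w * s) * (c0 + eps * s))).
    { apply Rmult_le_compat_r; [apply Rmult_le_pos; lra|lra]. }
    assert (H6 : 1 <= exp (w * s) * exp (w * d)) by nra.
    assert (H7 : eps * d <= (exp (w * s) * exp (w * d)) * (eps * d)).
    { rewrite <- (Rmult_1_l (eps * d)) at 1. apply Rmult_le_compat_r; [nra|exact H6]. }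
    lra. }
  assert (Hgmono : forall s s', 0 <= s <= s' -> g s <= g s').
  { intros s s' Hs. specialize (Hstep s (s' - s) ltac:(lra) ltac:(lra)).
    replace (s + (s' - s)) with s' in Hstep by ring.
    pose proof (Hg0 s ltac:(lra)).
    assert (0 <= w * (s' - s)) by (apply Rmult_le_pos; lra).
    assert (0 <= eps * (s' - s)) by (apply Rmult_le_pos; lra). nra. }
  (* Times up to which the bound holds. [Hleft] gives the bound at the supremum m, and [Hright]
     would extend it beyond m if m < t. *)
  set (E := fun r => 0 <= r <= t /\ forall s, 0 <= s <= r -> P s (g s)).
  assert (E0 : E 0).
  { split; [lra|]. intros s Hs. replace s with 0 by lra.
    unfold g. rewrite Rmult_0_r, exp_0, Rmult_0_r, Rmult_1_l, Rplus_0_r. exact Hinit. }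
  destruct (completeness E) as [m [Hub Hlub]].
  { exists t. intros r [Hr _]. lra. }
  { now exists 0. }
  assert (Hm0 : 0 <= m) by (apply Hub, E0).
  assert (Hmt : m <= t) by (apply Hlub; intros r [Hr _]; lra).
  assert (Hlt : forall s, 0 <= s < m -> P s (g s)).
  { intros s Hs. apply NNPP; intros Hn.
    assert (m <= s); [|lra]. apply Hlub. intros r [Hr HP].
    apply Rnot_lt_le; intros Hlt. apply Hn, HP. lra. }
  assert (Pm : P m (g m)).
  { destruct (Rle_lt_or_eq_dec 0 m Hm0) as [h|<-].
    - apply Hleft; [exact h|now apply Hg0|]. intros s Hs.
      apply Hmono with (g s); [now apply Hlt|]. apply Hgmono; lra.
    - apply E0. lra. }
  destruct (Rle_lt_or_eq_dec m t Hmt) as [h| ->]; [exfalso|exact Pm].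
  destruct (Hright m (g m) eps Hm0 (Hg0 m Hm0) Pm He) as [d [dp Hd]].
  set (k := Rmin (d / 2) (t - m)).
  assert (0 < k) by (apply Rmin_pos; lra).
  assert (k <= d / 2) by apply Rmin_l. assert (k <= t - m) by apply Rmin_r.
  assert (Ek : E (m + k)).
  { split; [lra|]. intros s Hs. destruct (Rle_lt_dec s m) as [h1|h1].
    - destruct (Rle_lt_or_eq_dec s m h1) as [h2| ->]; [apply Hlt; lra|exact Pm].
    - replace s with (m + (s - m)) by ring.
      apply Hmono with ((1 + w * (s - m)) * g m + eps * (s - m)).
      + apply Hd. lra.
      + apply Hstep; lra. }
  specialize (Hub _ Ek). lra.
Qed.

Section Growth.
Variables (a b : R) (T : R -> (R -> C) -> R -> C).
Hypothesis ab : a <= b.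
Let D := Icc a b.
Hypothesis HT : C0_semigroup D T.
Variables (dom : (R -> C) -> Prop) (G : (R -> C) -> R -> C).
Hypothesis HG : is_generator D T dom G.
Hypothesis Hdom : forall f, dom f -> cont D f /\ cont D (G f).

Lemma at_right_sup_norm_intro (F : R -> R -> C) :
  (forall s, 0 < s -> cont D (F s)) ->
  (forall eps, 0 < eps ->
     exists d, 0 < d /\ forall s, 0 < s < d -> bounded_by D eps (F s)) ->
  filterlim (fun t => sup_norm D (F t)) (at_right 0) (locally 0).
Proof.
  intros HF H P [e HP].
  destruct (H (e / 2)) as [d [dp Hd]]; [destruct e; simpl; lra|].
  exists (mkposreal d dp). intros s Hs Hs0. apply HP.
  unfold ball in Hs |- *; simpl in Hs |- *.
  unfold AbsRing_ball, abs, minus, plus, opp in Hs |- *; simpl in Hs |- *.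
  rewrite Ropp_0, Rplus_0_r in Hs |- *.
  rewrite Rabs_pos_eq in Hs by lra.
  pose proof (sup_norm_pos a b ab (F s) (HF s Hs0)).
  pose proof (sup_norm_le a b ab (F s) (e / 2) (Hd s (conj Hs0 Hs))).
  fold D in H0. rewrite Rabs_pos_eq by assumption.
  eapply Rle_lt_trans; [exact H1|]. destruct e; simpl; lra.
Qed.

Lemma cont_difference_quotient s f g : 0 <= s -> cont D f -> cont D g ->
  cont D (fun x => ((T s f x - f x) / RtoC s - g x)%C).
Proof.
  intros Hs Hf Hg. apply cont_Cminus; [|exact Hg].
  replace (fun x => ((T s f x - f x) / RtoC s)%C)
    with (fun x => (/ RtoC s * T s f x + (- / RtoC s) * f x)%C)
    by (extensionality x; unfold Cdiv; ring).
  apply cont_lincomb; [now apply (sg_cont _ _ HT)|exact Hf].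
Qed.

Lemma generator_eps f eps : dom f -> 0 < eps ->
  exists d, 0 < d /\ forall s, 0 < s < d ->
    bounded_by D eps (fun x => ((T s f x - f x) / RtoC s - G f x)%C).
Proof.
  intros Hf He. destruct (Hdom f Hf) as [Cf CG].
  apply (at_right_sup_norm_eps a b ab (fun s x => ((T s f x - f x) / RtoC s - G f x)%C)).
  - intros s Hs. apply cont_difference_quotient; [lra|exact Cf|exact CG].
  - apply (proj2 (HG f (G f) Cf CG)). split; [exact Hf|reflexivity].
  - exact He.
Qed.

(** T t commutes with T s, so it maps the difference quotients of f to those of T t f; its
    boundedness carries the limit over, and the equivalence in [is_generator] turns this into
    membership in the domain. *)
Lemma generator_invariant t f : 0 <= t -> dom f ->
  dom (T t f) /\ forall x, D x -> T t (G f) x = G (T t f) x.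
Proof.
  intros Ht Hf. destruct (Hdom f Hf) as [Cf CG].
  assert (CTf : cont D (T t f)) by now apply (sg_cont _ _ HT).
  assert (CTG : cont D (T t (G f))) by now apply (sg_cont _ _ HT).
  apply (HG _ _ CTf CTG). apply at_right_sup_norm_intro.
  { intros s Hs. apply cont_difference_quotient; [lra|exact CTf|exact CTG]. }
  intros eps He.
  destruct (semigroup_bounded a b T ab HT t Ht) as [M [HM HMb]].
  assert (He' : 0 < eps / (M + 1)) by (apply Rdiv_lt_0_compat; lra).
  destruct (generator_eps f _ Hf He') as [d [dp Hd]].
  exists d; split; [exact dp|]. intros s Hs x Dx.
  assert (CTs : cont D (T s f)) by (apply (sg_cont _ _ HT); [lra|exact Cf]).
  assert (Cq : cont D (fun x => (/ RtoC s * T s f x + (- / RtoC s) * f x)%C))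
    by now apply cont_lincomb.
  assert (E : T t (fun x => ((T s f x - f x) / RtoC s - G f x)%C) x
    = ((T s (T t f) x - T t f x) / RtoC s - T t (G f) x)%C).
  { replace (fun x => ((T s f x - f x) / RtoC s - G f x)%C)
      with (fun x => ((/ RtoC s * T s f x + (- / RtoC s) * f x) - G f x)%C)
      by (extensionality y; unfold Cdiv; ring).
    rewrite (semigroup_minus a b T HT t _ (G f)) by assumption.
    rewrite (semigroup_lincomb a b T HT) by assumption.
    rewrite <- (sg_add _ _ HT t s f) by (assumption || lra).
    rewrite Rplus_comm, (sg_add _ _ HT s t f) by (assumption || lra).
    unfold Cdiv; ring. }
  rewrite <- E. eapply Rle_trans.
  - apply (HMb _ (eps / (M + 1))); [|apply Hd, Hs|exact Dx].
    apply cont_difference_quotient; [lra|exact Cf|exact CG].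
  - replace eps with ((M + 1) * (eps / (M + 1))) at 2 by (field; lra).
    apply Rmult_le_compat_r; lra.
Qed.

Variable w : R.
Hypothesis Hw0 : 0 <= w.
Hypothesis Hdiss : forall f s c, dom f -> 0 <= s -> 0 <= 1 - s * w ->
  bounded_by D c (fun x => (f x - RtoC s * G f x)%C) ->
  forall x, D x -> (1 - s * w) * Cmod (f x) <= c.

(* The resolvent bound is applied to [T (t + s) f], because
   [(1 - s G) (T (t + s) f) = T t f + o(s)]. *)
Lemma dissipative_growth f c t : dom f -> bounded_by D c f -> 0 <= t ->
  bounded_by D (exp (2 * w * t) * c) (T t f).
Proof.
  intros Hf Hc. destruct (Hdom f Hf) as [Cf CG].
  assert (Hc0 : 0 <= c).
  { eapply Rle_trans; [apply Cmod_ge_0|]. apply (Hc a). split; lra. }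
  apply (gronwall_induction (fun t c => bounded_by D c (T t f))).
  - lra.
  - exact Hc0.
  - intros r k k' H Hk x Dx. eapply Rle_trans; [apply H, Dx|exact Hk].
  - intros x Dx. rewrite (sg_zero _ _ HT f Cf x Dx). now apply Hc.
  - clear t c Hc Hc0. intros t c eps Ht Hc0 Hc He.
    destruct (generator_invariant t f Ht Hf) as [Hv _]. set (v := T t f) in *.
    destruct (Hdom v Hv) as [Cv CGv].
    (* Two errors of eps / 4, doubled by the factor 1 + 2 s w <= 2, make up the permitted eps. *)
    assert (He4 : 0 < eps / 4) by lra.
    destruct (generator_eps v _ Hv He4) as [d1 [d1p H1]].
    destruct (semigroup_strong a b T ab HT (G v) (eps / 4) CGv He4) as [d2 [d2p H2]].
    (* Such s satisfy s w <= 1/2, the range in which 1 / (1 - s w) <= 1 + 2 s w. *)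
    assert (Hd3 : 0 < / (2 * (w + 1))) by (apply Rinv_0_lt_compat; lra).
    exists (Rmin (Rmin d1 d2) (/ (2 * (w + 1)))).
    split; [repeat apply Rmin_pos; assumption|]. intros s [Hs0 Hs] x Dx.
    pose proof (Rmin_l (Rmin d1 d2) (/ (2 * (w + 1)))).
    pose proof (Rmin_r (Rmin d1 d2) (/ (2 * (w + 1)))).
    pose proof (Rmin_l d1 d2). pose proof (Rmin_r d1 d2).
    assert (Hsw : s * w <= / 2).
    { apply Rle_trans with (/ (2 * (w + 1)) * (w + 1)).
      - apply Rmult_le_compat; lra.
      - right. field. lra. }
    assert (Hsw0 : 0 <= s * w) by (apply Rmult_le_pos; lra).
    destruct (generator_invariant s v ltac:(lra) Hv) as [Hsv HGs].
    assert (Hb : bounded_by D (c + eps / 2 * s)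
      (fun y => (T s v y - RtoC s * G (T s v) y)%C)).
    { intros y Dy. rewrite <- HGs by exact Dy.
      assert (Hsne : RtoC s <> 0) by (intros E; apply RtoC_inj in E; lra).
      (* Beyond v there remain s times the error of the difference quotient and s times T s (G v) -
         G v; both factors are small. *)
      replace (T s v y - RtoC s * T s (G v) y)%C
        with (v y + (RtoC s * ((T s v y - v y) / RtoC s - G v y)
              + - (RtoC s * (T s (G v) y - G v y))))%C by (field; exact Hsne).
      eapply Rle_trans; [apply Cmod_triangle|].
      apply Rplus_le_compat; [apply Hc, Dy|].
      eapply Rle_trans; [apply Cmod_triangle|].
      rewrite Cmod_opp, !Cmod_mult, Cmod_R, Rabs_pos_eq by lra.
      specialize (H1 s ltac:(lra) y Dy). specialize (H2 s ltac:(lra) y Dy).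
      cbv beta in H1, H2. nra. }
    pose proof (Hdiss (T s v) s _ Hsv ltac:(lra) ltac:(lra) Hb x Dx) as Hfin.
    rewrite Rplus_comm, (sg_add _ _ HT s t f) by (assumption || lra). fold v.
    set (z := Cmod (T s v x)) in *.
    assert (Hz : 0 <= z) by apply Cmod_ge_0.
    (* With x = s w one has (1 + 2 x) (1 - x) = 1 + x (1 - 2 x) >= 1. *)
    assert (Hz2 : z <= (1 + 2 * (s * w)) * ((1 - s * w) * z)).
    { assert (0 <= s * w * (1 - 2 * (s * w)) * z)
        by (repeat apply Rmult_le_pos; lra). lra. }
    assert (Hz3 : (1 + 2 * (s * w)) * ((1 - s * w) * z)
      <= (1 + 2 * (s * w)) * (c + eps / 2 * s)) by (apply Rmult_le_compat_l; lra).
    assert (0 <= eps / 2 * s) by (apply Rmult_le_pos; lra).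
    assert ((1 + 2 * (s * w)) * (eps / 2 * s) <= 2 * (eps / 2 * s))
      by (apply Rmult_le_compat_r; lra).
    lra.
  - clear t c Hc Hc0. intros t c Ht Hc0 H x Dx.
    apply le_epsilon. intros e He.
    destruct (semigroup_left_continuous a b T ab HT t f e Ht Cf He) as [d [dp Hd]].
    set (s := Rmin (d / 2) t).
    assert (0 < s) by (apply Rmin_pos; lra).
    assert (s <= d / 2) by apply Rmin_l. assert (s <= t) by apply Rmin_r.
    specialize (Hd s ltac:(lra) ltac:(lra) x Dx). cbv beta in Hd.
    specialize (H (t - s) ltac:(lra) x Dx).
    replace (T t f x) with ((T t f x - T (t - s) f x) + T (t - s) f x)%C by ring.
    eapply Rle_trans; [apply Cmod_triangle|]. lra.
  - intros r k H x Dx. apply le_epsilon. intros e He. now apply H.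
Qed.

End Growth.

(** * The master equation and the normalisation Q_N *)

Lemma finite_uniform_delta (Q : nat -> R -> Prop) (N : nat) :
  (forall k, (k <= N)%nat -> exists d, 0 < d /\ forall s, 0 < s < d -> Q k s) ->
  exists d, 0 < d /\ forall s k, 0 < s < d -> (k <= N)%nat -> Q k s.
Proof.
  induction N as [|N IH]; intros H.
  - destruct (H 0%nat (le_n _)) as [d [dp Hd]]. exists d; split; [exact dp|].
    intros s k Hs Hk. replace k with 0%nat by lia. now apply Hd.
  - destruct IH as [d1 [d1p H1]]; [intros k Hk; apply H; lia|].
    destruct (H (S N) (le_n _)) as [d2 [d2p H2]].
    exists (Rmin d1 d2); split; [now apply Rmin_pos|]. intros s k Hs Hk.
    pose proof (Rmin_l d1 d2). pose proof (Rmin_r d1 d2).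
    destruct (Nat.eq_dec k (S N)) as [->|Hne]; [apply H2; lra|].
    apply H1; [lra|lia].
Qed.

Section MasterEquation.
Variables (fA fC : R -> R) (N : nat) (L1 L2 : R).
Let up := rate_up fA N.
Let down := rate_down fC N.
Hypothesis HL1 : 0 <= L1.
Hypothesis HL2 : 0 <= L2.
Hypothesis Hup : forall k, (k <= N)%nat -> 0 <= up k.
Hypothesis Hdown : forall k, (k <= N)%nat -> 0 <= down k.
Hypothesis Hup_lip : forall k, (S k <= N)%nat -> up k - up (S k) <= L1.
Hypothesis Hdown_lip : forall k, (S k <= N)%nat -> down (S k) - down k <= L2.

(** For small s an explicit Euler step has non-negative coefficients, of total 1 + s (a_{k-1} - a_k
    + c_{k+1} - c_k), and neighbouring rates differ by at most L1 and L2 in the relevant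
    direction. *)
Lemma master_euler_step p k t s c : (k <= N)%nat -> 0 <= c -> 0 <= s ->
  s * (up k + down k) <= 1 ->
  (forall j, (j <= N)%nat -> Rabs (p j t) <= c) ->
  Rabs (p k t + s * master_rhs fA fC N p k t) <= (1 + (L1 + L2) * s) * c.
Proof.
  intros Hk Hc Hs Hsmall Hp.
  pose proof (Hup k Hk) as Hu. pose proof (Hdown k Hk) as Hd.
  assert (HX : exists u, 0 <= u /\ u <= up k + L1 /\
    Rabs (match k with O => 0 | S j => rate_up fA N j * p j t end) <= u * c).
  { destruct k as [|j].
    (* The absent term counts with rate 0, which is still at most [up k + L1] by non-negativity;
       likewise at k = N below. *)
    - exists 0. rewrite Rabs_R0. lra.
    - exists (up j). pose proof (Hup_lip j Hk). pose proof (Hup j ltac:(lia)) as Hj.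
      split; [exact Hj|]. split; [lra|].
      fold up. rewrite Rabs_mult, (Rabs_pos_eq (up j)) by exact Hj.
      apply Rmult_le_compat_l; [exact Hj|]. apply Hp; lia. }
  assert (HY : exists u, 0 <= u /\ u <= down k + L2 /\
    Rabs (if Nat.ltb k N then rate_down fC N (S k) * p (S k) t else 0) <= u * c).
  { destruct (Nat.ltb_spec k N) as [Hlt|Hge].
    - exists (down (S k)). pose proof (Hdown_lip k Hlt). pose proof (Hdown (S k) Hlt) as Hj.
      split; [exact Hj|]. split; [lra|].
      fold down. rewrite Rabs_mult, (Rabs_pos_eq (down (S k))) by exact Hj.
      apply Rmult_le_compat_l; [exact Hj|]. now apply Hp.
    - exists 0. rewrite Rabs_R0. lra. }
  unfold master_rhs.
  set (X := match k with O => 0 | S j => rate_up fA N j * p j t end) in *.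
  set (Y := if Nat.ltb k N then rate_down fC N (S k) * p (S k) t else 0) in *.
  fold up down.
  destruct HX as [u [Hu0 [Hu1 HX]]]. destruct HY as [v [Hv0 [Hv1 HY]]].
  replace (p k t + s * (X - (up k + down k) * p k t + Y))
    with ((1 - s * (up k + down k)) * p k t + (s * X + s * Y)) by ring.
  eapply Rle_trans; [apply Rabs_triang|].
  eapply Rle_trans; [apply Rplus_le_compat_l, Rabs_triang|].
  rewrite !Rabs_mult, (Rabs_pos_eq s), (Rabs_pos_eq (1 - s * (up k + down k))) by lra.
  assert (H1 : (1 - s * (up k + down k)) * Rabs (p k t) <= (1 - s * (up k + down k)) * c)
    by (apply Rmult_le_compat_l; [lra|now apply Hp]).
  assert (H2 : s * Rabs X <= s * (u * c)) by (apply Rmult_le_compat_l; lra).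
  assert (H3 : s * Rabs Y <= s * (v * c)) by (apply Rmult_le_compat_l; lra).
  assert (H4 : 0 <= s * c * (up k + down k + L1 + L2 - u - v))
    by (repeat apply Rmult_le_pos; lra).
  lra.
Qed.

Lemma master_solution_bound p p0 c t :
  master_solution fA fC N p p0 -> 0 <= c ->
  (forall k, (k <= N)%nat -> Rabs (p0 k) <= c) -> 0 <= t ->
  forall k, (k <= N)%nat -> Rabs (p k t) <= exp ((L1 + L2) * t) * c.
Proof.
  intros Hsol Hc Hp0 Ht.
  apply (gronwall_induction (fun t c => forall k, (k <= N)%nat -> Rabs (p k t) <= c));
    [lra|exact Hc| | | | | |exact Ht].
  - intros r k k' H Hk j Hj. eapply Rle_trans; [apply H, Hj|exact Hk].
  - intros k Hk. rewrite (proj1 (Hsol k Hk)). now apply Hp0.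
  - clear t c Hc Hp0 Ht. intros t c eps Ht Hc Hp He.
    destruct (finite_uniform_delta (fun k s =>
      Rabs (p k (t + s)) <= (1 + (L1 + L2) * s) * c + eps * s) N) as [d [dp Hd]].
    (* By differentiability p k (t + s) is the Euler step up to an error eps s. *)
    + intros k Hk. destruct (Hsol k Hk) as [_ Hder].
      destruct (is_derive_within_R_eps _ _ _ _ (Hder t Ht) eps He) as [d [dp Hd]].
      pose proof (Hup k Hk). pose proof (Hdown k Hk).
      assert (Hq : 0 < / (up k + down k + 1)) by (apply Rinv_0_lt_compat; lra).
      exists (Rmin d (/ (up k + down k + 1))).
      split; [now apply Rmin_pos|]. intros s [Hs0 Hs].
      pose proof (Rmin_l d (/ (up k + down k + 1))).
      pose proof (Rmin_r d (/ (up k + down k + 1))).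
      specialize (Hd (t + s) ltac:(lra)). replace (t + s - t) with s in Hd by ring.
      rewrite (Rabs_pos_eq s) in Hd by lra. specialize (Hd ltac:(lra)).
      assert (Hsmall : s * (up k + down k) <= 1).
      { apply Rle_trans with (/ (up k + down k + 1) * (up k + down k + 1)).
        - apply Rmult_le_compat; lra.
        - right. apply Rinv_l. lra. }
      pose proof (master_euler_step p k t s c Hk Hc ltac:(lra) Hsmall Hp) as Hstep.
      replace (p k (t + s)) with ((p k t + s * master_rhs fA fC N p k t)
        + (p k (t + s) - p k t - s * master_rhs fA fC N p k t)) by ring.
      eapply Rle_trans; [apply Rabs_triang|]. lra.
    + exists d; split; [exact dp|]. intros s Hs k Hk. now apply Hd.
  - clear t c Hc Hp0 Ht. intros t c Ht Hc H k Hk. apply le_epsilon. intros e He.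
    destruct (Hsol k Hk) as [_ Hder].
    set (m := master_rhs fA fC N p k t) in *.
    (* Only left continuity is wanted, so the crude tolerance 1 suffices: p k changes by at most s
       (|m| + 1) over the time s. *)
    destruct (is_derive_within_R_eps _ _ _ _ (Hder t ltac:(lra)) 1 Rlt_0_1) as [d [dp Hd]].
    fold m in Hd. pose proof (Rabs_pos m) as Hm.
    assert (He' : 0 < e / (Rabs m + 1)) by (apply Rdiv_lt_0_compat; lra).
    set (s := Rmin (Rmin (d / 2) t) (e / (Rabs m + 1))).
    assert (Hs0 : 0 < s) by (repeat apply Rmin_pos; lra).
    assert (Hs1 : s <= Rmin (d / 2) t) by apply Rmin_l.
    assert (Hs2 : s <= e / (Rabs m + 1)) by apply Rmin_r.
    pose proof (Rmin_l (d / 2) t). pose proof (Rmin_r (d / 2) t).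
    specialize (Hd (t - s) ltac:(lra)). replace (t - s - t) with (- s) in Hd by ring.
    rewrite Rabs_Ropp, (Rabs_pos_eq s) in Hd by lra. specialize (Hd ltac:(lra)).
    specialize (H (t - s) ltac:(lra) k Hk).
    assert (Hse : s * (Rabs m + 1) <= e).
    { apply Rle_trans with (e / (Rabs m + 1) * (Rabs m + 1)).
      - apply Rmult_le_compat_r; lra.
      - right. field. lra. }
    replace (p k t) with (p k (t - s) + (- (p k (t - s) - p k t - - s * m) + s * m)) by ring.
    eapply Rle_trans; [apply Rabs_triang|].
    eapply Rle_trans; [apply Rplus_le_compat_l, Rabs_triang|].
    rewrite Rabs_Ropp, Rabs_mult, (Rabs_pos_eq s) by lra. lra.
  - intros r j H k Hk. apply le_epsilon. intros e He. now apply H.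
Qed.

End MasterEquation.

(** * Bounds on an interval and linear growth of Q_N *)

Lemma continuous_on_bounded (a b : R) (f : R -> R) :
  a <= b -> continuous_on (U := R_UniformSpace) (Icc a b) f ->
  exists M, 0 <= M /\ forall x, Icc a b x -> Rabs (f x) <= M.
Proof.
  intros ab Hf.
  destruct (continuous_on_max a b f ab Hf) as [x1 [_ H1]].
  destruct (continuous_on_max a b (fun x => (-1) * f x) ab
    (continuous_on_Rscal _ (-1) f Hf)) as [x2 [_ H2]].
  exists (Rmax 0 (Rmax (f x1) (- f x2))). split; [apply Rmax_l|].
  intros x Dx. specialize (H1 x Dx). specialize (H2 x Dx). cbv beta in H2.
  pose proof (Rmax_r 0 (Rmax (f x1) (- f x2))).
  pose proof (Rmax_l (f x1) (- f x2)). pose proof (Rmax_r (f x1) (- f x2)).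
  apply Rabs_le. lra.
Qed.

(** x and y lie strictly inside so that two-sided derivatives exist on the closed segment; for grid
    points of [0, 1] in [-eta, 1 + eta] this is automatic. *)
Lemma derivative_bound_lipschitz (a b M : R) (f f1 : R -> R) (x y : R) :
  (forall z, Icc a b z -> is_derive_within (V := R_CompleteNormedModule) (Icc a b) f z (f1 z)) ->
  (forall z, Icc a b z -> Rabs (f1 z) <= M) ->
  a < x -> x < y -> y < b -> Rabs (f y - f x) <= M * (y - x).
Proof.
  intros H HM Hx Hxy Hy.
  destruct (MVT_cor2 f f1 x y Hxy) as [c [E Hc]].
  { intros c Hc. apply is_derive_within_interior with a b; [lra|]. apply H. split; lra. }
  rewrite E, Rabs_mult, (Rabs_pos_eq (y - x)) by lra.
  apply Rmult_le_compat_r; [lra|]. apply HM. split; lra.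
Qed.

(** Grid points in [al, be] are counted by telescoping: [clamp A B (INR n)] rises by at most 1 per
    step, and a rise on reaching n forces n / N into [al, be], where the summand is at least m. *)
Lemma Qsum_lower_bound_interval (u : R -> R) (m al be : R) (N : nat) :
  0 <= m -> 0 <= al -> be <= 1 -> (0 < N)%nat -> al * INR N <= be * INR N - 1 ->
  (forall x, 0 <= x <= 1 -> 0 <= u x) ->
  (forall x, al <= x <= be -> m <= u x) ->
  m * ((be - al) * INR N - 1) <= Qsum u N.
Proof.
  intros Hm Hal Hbe HN Hab Hu Hum.
  assert (HNp : 0 < INR N) by now apply lt_0_INR.
  (* B is be N - 1 because a rise from n to n + 1 requires n < B, and then n + 1 < be N. *)
  set (A := al * INR N) in *. set (B := be * INR N - 1) in *.
  assert (HA : 0 <= A) by (apply Rmult_le_pos; lra).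
  assert (HB : B <= INR N - 1) by (unfold B; nra).
  assert (Hdiv : forall n, (n <= N)%nat -> 0 <= INR n / INR N <= 1).
  { intros n Hn. apply le_INR in Hn. pose proof (pos_INR n). split.
    - apply Rdiv_le_0_compat; lra.
    - apply Rmult_le_reg_r with (INR N); [exact HNp|].
      unfold Rdiv. rewrite Rmult_assoc, Rinv_l; lra. }
  assert (Hind : forall n, (n <= N)%nat ->
    m * (clamp A B (INR n) - A) <= sum_f_R0 (fun k => u (INR k / INR N)) n).
  { induction n as [|n IH]; intros Hn.
    - simpl sum_f_R0. replace (clamp A B (INR 0)) with A.
      + rewrite Rminus_diag, Rmult_0_r. exact (Hu _ (Hdiv 0%nat Hn)).
      + simpl. unfold clamp, Rmax, Rmin. repeat destruct Rle_dec; lra.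
    - rewrite tech5. specialize (IH ltac:(lia)).
      enough (m * (clamp A B (INR (S n)) - clamp A B (INR n)) <= u (INR (S n) / INR N)) by lra.
      destruct (Rle_dec (clamp A B (INR (S n)) - clamp A B (INR n)) 0) as [h|h].
      + apply Rle_trans with 0; [nra|]. apply Hu, Hdiv, Hn.
      + assert (Hle1 : clamp A B (INR (S n)) - clamp A B (INR n) <= 1).
        { eapply Rle_trans; [apply Rle_abs|]. eapply Rle_trans; [apply clamp_lipschitz|].
          rewrite S_INR. replace (INR n + 1 - INR n) with 1 by ring. rewrite Rabs_R1. lra. }
        apply Rle_trans with m; [nra|]. apply Hum.
        assert (HAB : A <= INR (S n) <= B + 1).
        { rewrite S_INR in *. revert h. unfold clamp, Rmax, Rmin.
          repeat destruct Rle_dec; intros; lra. }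
        split.
        * apply Rmult_le_reg_r with (INR N); [exact HNp|].
          unfold Rdiv. rewrite Rmult_assoc, Rinv_l; unfold A in HAB; lra.
        * apply Rmult_le_reg_r with (INR N); [exact HNp|].
          unfold Rdiv. rewrite Rmult_assoc, Rinv_l; unfold B in HAB; lra. }
  specialize (Hind N (le_n _)).
  replace (clamp A B (INR N)) with B in Hind.
  - unfold Qsum. eapply Rle_trans; [|exact Hind]. right. unfold A, B. ring.
  - unfold clamp, Rmax, Rmin. repeat destruct Rle_dec; lra.
Qed.

(** Deals with the finitely many N whose grid is too coarse for the counting estimate; for these
    only Q N > 0 is known. *)
Lemma finite_positive_lower_bound (Q : nat -> R) (n : nat) :
  exists c, 0 < c /\ forall N, (N <= n)%nat -> 0 < Q N -> c <= Q N.
Proof.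
  induction n as [|n [c [cp Hc]]].
  - destruct (Rlt_dec 0 (Q 0%nat)) as [h|h].
    + exists (Q 0%nat). split; [exact h|]. intros N HN _. replace N with 0%nat by lia. lra.
    + exists 1. split; [lra|]. intros N HN H. replace N with 0%nat in H by lia. lra.
  - exists (if Rlt_dec 0 (Q (S n)) then Rmin c (Q (S n)) else c).
    destruct (Rlt_dec 0 (Q (S n))) as [h|h].
    + split; [now apply Rmin_pos|]. intros N HN H.
      destruct (Nat.eq_dec N (S n)) as [->|Hne]; [apply Rmin_r|].
      eapply Rle_trans; [apply Rmin_l|]. apply Hc; [lia|exact H].
    + split; [exact cp|]. intros N HN H.
      destruct (Nat.eq_dec N (S n)) as [->|Hne]; [lra|]. apply Hc; [lia|exact H].
Qed.

Lemma Qsum_linear_growth (u : R -> R) :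
  continuous_on (U := R_UniformSpace) (Icc 0 1) u ->
  (forall x, 0 <= x <= 1 -> 0 <= u x) ->
  (exists x, 0 <= x <= 1 /\ u x <> 0) ->
  exists c, 0 < c /\ forall N, 0 < Qsum u N -> c * INR N <= Qsum u N.
Proof.
  intros Hc Hu [x0 [D0 Hx0]].
  assert (Hp : 0 < u x0) by (specialize (Hu x0 D0); lra).
  set (m := u x0 / 2).
  destruct (within_locally_eps (Icc 0 1) x0 (fun y => m <= u y)) as [d [dp Hd]].
  { apply (Hc x0 D0 (fun z => m <= z)).
    assert (Hm : 0 < m) by (unfold m; lra).
    exists (mkposreal m Hm). intros z Hz.
    change (Rabs (z - u x0) < m) in Hz. apply Rabs_def2 in Hz. unfold m in *; lra. }
  set (al := Rmax 0 (x0 - d / 2)). set (be := Rmin 1 (x0 + d / 2)).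
  assert (Hal : 0 <= al /\ x0 - d / 2 <= al /\ al <= x0)
    by (unfold al, Rmax; destruct Rle_dec; lra).
  assert (Hbe : be <= 1 /\ be <= x0 + d / 2 /\ x0 <= be)
    by (unfold be, Rmin; destruct Rle_dec; lra).
  assert (Hab : al < be)
    by (unfold al, be, Rmax, Rmin; repeat destruct Rle_dec; lra).
  assert (Hum : forall x, al <= x <= be -> m <= u x).
  { intros x Hx. apply Hd; [split; lra|]. apply Rabs_def1; lra. }
  (* For N > n one has (be - al) N >= 2, so the count (be - al) N - 1 is at least half of (be - al)
     N. *)
  destruct (nfloor_ex (2 / (be - al))) as [n [_ Hn]].
  { apply Rdiv_le_0_compat; lra. }
  destruct (finite_positive_lower_bound (Qsum u) n) as [c [cp Hcl]].
  pose proof (pos_INR n) as Hn0.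
  set (c1 := c / (INR n + 1)).
  assert (Hc1 : 0 < c1) by (apply Rdiv_lt_0_compat; lra).
  assert (Hm : 0 < m) by (unfold m; lra).
  set (c2 := m * (be - al) / 2).
  assert (Hc2 : 0 < c2) by (apply Rdiv_lt_0_compat; [apply Rmult_lt_0_compat|]; lra).
  exists (Rmin c1 c2). split; [now apply Rmin_pos|]. intros N HQ.
  pose proof (pos_INR N) as HN0.
  destruct (Nat.le_gt_cases N n) as [HN|HN].
  - apply Rle_trans with (c1 * INR N); [apply Rmult_le_compat_r; [exact HN0|apply Rmin_l]|].
    apply Rle_trans with c; [|now apply Hcl].
    apply le_INR in HN. apply Rle_trans with (c1 * (INR n + 1)).
    + apply Rmult_le_compat_l; lra.
    + right. unfold c1. field. lra.
  - apply Rle_trans with (c2 * INR N); [apply Rmult_le_compat_r; [exact HN0|apply Rmin_r]|].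
    assert (HN2 : 2 <= (be - al) * INR N).
    { replace 2 with ((be - al) * (2 / (be - al))) by (field; lra).
      apply Rmult_le_compat_l; [lra|]. assert (INR n + 1 <= INR N); [|lra].
      rewrite <- S_INR. apply le_INR. lia. }
    eapply Rle_trans; [|apply (Qsum_lower_bound_interval u m al be N)]; try assumption; try lra.
    + unfold c2. nra.
    + lia.
Qed.

(** * The error estimate *)

Section Bounds.
Variables (fA fC A1 A2 C1 C2 : R -> R) (N : nat) (w : R).
Hypothesis HN : (0 < N)%nat.
Let h := mesh N.
Let D := dom_interval N.
Hypothesis HA1 : forall x, D x -> is_derive_within (V := R_CompleteNormedModule) D fA x (A1 x).
Hypothesis HA2 : forall x, D x -> is_derive_within (V := R_CompleteNormedModule) D A1 x (A2 x).
Hypothesis HC1 : forall x, D x -> is_derive_within (V := R_CompleteNormedModule) D fC x (C1 x).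
Hypothesis HC2 : forall x, D x -> is_derive_within (V := R_CompleteNormedModule) D C1 x (C2 x).
Hypothesis CA2 : continuous_on (U := R_UniformSpace) D A2.
Hypothesis CC2 : continuous_on (U := R_UniformSpace) D C2.
Hypothesis Hw0 : 0 <= w.
Hypothesis Hw : forall x, D x -> h * (A2 x + C2 x) - (A1 x - C1 x) <= w.
Hypothesis Hpos : forall x, D x -> 0 < fA x + fC x.
Hypothesis Hl : h * Rabs (A1 (- h) + C1 (- h)) < fA (- h) - fC (- h).
Hypothesis Hr : fA (1 + h) - fC (1 + h) < - (h * Rabs (A1 (1 + h) + C1 (1 + h))).

Lemma FP_semigroup_growth S f c t :
  FP_semigroup fA fC N S -> FP_dom fA fC N f -> bounded_by D c f -> 0 <= t ->
  bounded_by D (exp (2 * w * t) * c) (S t f).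
Proof.
  intros [HS HG] Hf Hc Ht.
  apply (dissipative_growth (- mesh N) (1 + mesh N) S
    (Rlt_le _ _ (dom_interval_lt N HN)) HS (FP_dom fA fC N) (FP_op fA fC N) HG);
    [|exact Hw0| |exact Hf|exact Hc|exact Ht].
  - clear f Hf Hc. intros f [[f1 [Hf1 [f2 [Hf2 Cf2]]]] _]. split.
    + exact (is_derive_within_continuous_on (V := C_R_CompleteNormedModule) _ f f1 Hf1).
    + apply (cont_FP_op fA fC A1 A2 C1 C2 N) with f1 f2; assumption.
  - clear f c Hf Hc t Ht. intros f s c [[f1 [Hf1 [f2 [Hf2 _]]]] [Fl Fr]] Hs Hsw Hb x Dx.
    apply (FP_op_dissipative fA fC A1 A2 C1 C2 N) with f1 f2; assumption.
Qed.

(** The extended datum vanishes on the collars [-h, 0] and [1, 1 + h], hence so do its value and its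
    derivative at both ends, and the flux with them. *)
Lemma ext0_scaled_FP_dom (u : R -> R) (q : R) :
  u 0 = 0 -> u 1 = 0 -> C_on 2 (- mesh N) (1 + mesh N) (ext0 u) ->
  FP_dom fA fC N (fun z => RtoC (ext0 u z / q)).
Proof.
  intros Hu0 Hu1 [e1 [He1 [e2 [He2 Ce2]]]].
  pose proof (mesh_pos N HN) as hp. fold h in hp.
  assert (Hlin : forall e d x, D x ->
    is_derive_within (V := R_CompleteNormedModule) D e x (d x) ->
    is_derive_within (V := C_R_CompleteNormedModule) D
      (fun z => RtoC (e z / q)) x (RtoC (d x / q))).
  { intros e d x _ H. exact (is_derive_within_linear (V := R_CompleteNormedModule)
      (W := C_R_CompleteNormedModule) _ D e x (d x) (is_linear_RtoC_div q) H). }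
  (* The derivative within the large interval is also one within the collar, where uniqueness
     compares it with that of the zero function. *)
  assert (Hzero : forall c d x, c < d -> Icc c d x -> - h <= c -> d <= 1 + h ->
    (forall y, Icc c d y -> ext0 u y = 0) -> e1 x = 0).
  { intros c d x cd Dx Hc Hd Hz.
    assert (Dhx : Icc (- h) (1 + h) x) by (unfold Icc in *; lra).
    apply (is_derive_within_unique (V := R_CompleteNormedModule) c d (ext0 u) x _ _ cd Dx).
    - apply (is_derive_within_subset (V := R_CompleteNormedModule) (Icc (- h) (1 + h))).
      + intros y [H1 H2]. split; lra.
      + exact Dx.
      + apply He1, Dhx.
    - apply (is_derive_within_ext (V := R_CompleteNormedModule) _ (fun _ => 0)).
      + exact Dx.
      + intros y Dy. symmetry. now apply Hz.
      + unfold is_derive_within. apply (filterdiff_ext_lin _ (fun _ => zero)).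
        * apply filterdiff_const.
        * intros y. symmetry. apply (scal_zero_r (V := R_NormedModule)). }
  assert (Dl : D (- h)) by (unfold D, dom_interval, Icc; fold h; lra).
  assert (Dr : D (1 + h)) by (unfold D, dom_interval, Icc; fold h; lra).
  assert (Zl : forall y, Icc (- h) 0 y -> ext0 u y = 0).
  { intros y [H1 H2]. unfold ext0. destruct (Rle_dec 0 y); [|reflexivity].
    replace y with 0 by lra. destruct (Rle_dec 0 1); [exact Hu0|reflexivity]. }
  assert (Zr : forall y, Icc 1 (1 + h) y -> ext0 u y = 0).
  { intros y [H1 H2]. unfold ext0. destruct (Rle_dec 0 y); [|reflexivity].
    destruct (Rle_dec y 1); [|reflexivity]. replace y with 1 by lra. exact Hu1. }
  assert (El : e1 (- h) = 0).
  { apply (Hzero (- h) 0); try exact Zl; unfold Icc; lra. }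
  assert (Er : e1 (1 + h) = 0).
  { apply (Hzero 1 (1 + h)); try exact Zr; unfold Icc; lra. }
  assert (Hflux : forall z, D z -> ext0 u z = 0 -> e1 z = 0 ->
    FP_flux fA fC N (fun z => RtoC (ext0 u z / q)) z = RtoC 0).
  { intros z Dz E0 E1.
    rewrite (FP_flux_expand fA fC A1 C1 N HN HA1 HC1 _ (fun z => RtoC (e1 z / q)))
      by (assumption || (intros; apply Hlin; auto)).
    rewrite E0, E1. unfold Rdiv. rewrite Rmult_0_l. ring. }
  split; [|split].
  - exists (fun z => RtoC (e1 z / q)). split; [intros; apply Hlin; auto|].
    exists (fun z => RtoC (e2 z / q)). split; [intros; apply Hlin; auto|].
    intros x Dx. apply (filterlim_comp _ _ _ e2 (fun v : R => RtoC (v / q)) _ (locally (e2 x)));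
      [exact (Ce2 x Dx)|].
    apply (linear_cont (U := R_NormedModule) (V := C_R_NormedModule) _ _ (is_linear_RtoC_div q)).
  - apply Hflux; [exact Dl| |exact El]. apply Zl; unfold Icc; fold h; lra.
  - apply Hflux; [exact Dr| |exact Er]. apply Zr; unfold Icc; fold h; lra.
Qed.

End Bounds.

Theorem corollary4 :
  forall (eta : R) (fA fC : R -> R) (N0 : nat) (u0 : R -> R),
  0 < eta ->
  C_on 4 (- eta) (1 + eta) fA ->
  C_on 4 (- eta) (1 + eta) fC ->
  (forall x, 0 <= x <= 1 -> 0 <= fA x /\ 0 <= fC x) ->
  (forall x, - eta <= x <= 1 + eta -> 0 < fA x + fC x) ->
  fA 1 = 0 ->
  fC 0 = 0 ->
  (forall x, - eta <= x <= 0 -> 0 < fA x - fC x) ->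
  (forall x, 1 <= x <= 1 + eta -> fA x - fC x < 0) ->
  (0 < N0)%nat ->
  1 / (2 * eta) < INR N0 ->
  (forall x, - eta <= x <= 0 \/ 1 <= x <= 1 + eta ->
     Rabs (D_on (- eta) (1 + eta) fA x + D_on (- eta) (1 + eta) fC x)
     < 2 * INR N0 * Rabs (fA x - fC x)) ->
  C_on 2 0 1 u0 ->
  (forall x, 0 <= x <= 1 -> 0 <= u0 x) ->
  u0 0 = 0 -> D_on 0 1 u0 0 = 0 ->
  u0 1 = 0 -> D_on 0 1 u0 1 = 0 ->
  (forall N : nat, (N0 < N)%nat ->
     C_on 2 (- mesh N) (1 + mesh N) (ext0 u0)) ->
  (exists x, 0 <= x <= 1 /\ u0 x <> 0) ->
  forall t0 : R, 0 < t0 ->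
  exists K : R,
  forall N : nat, (N0 < N)%nat -> 0 < Qsum u0 N ->
  forall p : nat -> R -> R,
  master_solution fA fC N p (fun k => u0 (INR k / INR N) / Qsum u0 N) ->
  forall S : R -> (R -> C) -> R -> C,
  FP_semigroup fA fC N S ->
  forall (t : R) (k : nat), 0 <= t <= t0 -> (k <= N)%nat ->
  Cmod (S t (fun z => RtoC (ext0 u0 z / Qsum u0 N)%R) (INR k / INR N)%R
        - RtoC (p k t))%C <= K / INR N.
Proof.
  intros eta fA fC N0 u0 Heta HA HC Hnn Hpos _ _ Hl Hr HN0 HN0eta HN0d
    Hu Hunn Hu0 _ Hu1 _ Hext Hune t0 Ht0.
  destruct HA as [A1 [HA1 [A2 [HA2 CA]]]]. destruct HC as [C1 [HC1 [C2 [HC2 CC]]]].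
  apply Cn_on_continuous in CA. apply Cn_on_continuous in CC. apply Cn_on_continuous in Hu.
  assert (ab : - eta <= 1 + eta) by lra.
  destruct (continuous_on_bounded _ _ A1 ab
    (is_derive_within_continuous_on (V := R_CompleteNormedModule) _ _ _ HA2)) as [MA1 [MA1p HMA1]].
  destruct (continuous_on_bounded _ _ C1 ab
    (is_derive_within_continuous_on (V := R_CompleteNormedModule) _ _ _ HC2)) as [MC1 [MC1p HMC1]].
  destruct (continuous_on_bounded _ _ A2 ab CA) as [MA2 [MA2p HMA2]].
  destruct (continuous_on_bounded _ _ C2 ab CC) as [MC2 [MC2p HMC2]].
  destruct (continuous_on_bounded 0 1 u0 Rle_0_1 Hu) as [U [Up HU]].
  destruct (Qsum_linear_growth u0 Hu Hunn Hune) as [c [cp Hc]].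
  (* w bounds h (A'' + C'') - (A' - C') for all h <= 1, and L bounds the one-step variation of the
     rates; neither depends on N. *)
  set (w := MA2 + MC2 + MA1 + MC1). set (L := MA1 + MC1).
  exists ((exp (2 * w * t0) + exp (L * t0)) * U / c).
  intros N HN HQ p Hp S HS t k Ht Hk.
  set (Q := Qsum u0 N) in *.
  assert (HNpos : (0 < N)%nat) by lia.
  assert (HNp : 0 < INR N) by now apply lt_0_INR.
  pose proof (mesh_pos N HNpos) as hp.
  assert (HNN0 : INR N0 < INR N) by now apply lt_INR.
  assert (HN0p : 0 < INR N0) by now apply lt_0_INR.
  (* Turns the hypothesis on N0 into h |A' + C'| < |A - C| on the collars, the form needed at the
     end points. *)
  assert (HhN : 2 * INR N0 * mesh N <= 1).
  { unfold mesh. apply Rmult_le_reg_r with (2 * INR N); [lra|].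
    replace (2 * INR N0 * (1 / (2 * INR N)) * (2 * INR N)) with (2 * INR N0) by (field; lra). lra. }
  assert (Hh : mesh N < eta).
  { unfold mesh. apply Rmult_lt_reg_r with (2 * INR N); [lra|].
    replace (1 / (2 * INR N) * (2 * INR N)) with 1 by (field; lra).
    assert (H1 : 1 / (2 * eta) * (2 * eta) < INR N * (2 * eta)) by (apply Rmult_lt_compat_r; lra).
    replace (1 / (2 * eta) * (2 * eta)) with 1 in H1 by (field; lra). lra. }
  assert (Hh1 : mesh N <= 1).
  { assert (1 <= INR N0) by (change 1 with (INR 1); apply le_INR; lia). nra. }
  set (h := mesh N) in *.
  assert (Hsub : forall x, dom_interval N x -> Icc (- eta) (1 + eta) x).
  { intros x [H1 H2]. fold h in H1, H2. split; lra. }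
  assert (Hd : forall f f', (forall x, Icc (- eta) (1 + eta) x ->
      is_derive_within (V := R_CompleteNormedModule) (Icc (- eta) (1 + eta)) f x (f' x)) ->
      forall x, dom_interval N x ->
      is_derive_within (V := R_CompleteNormedModule) (dom_interval N) f x (f' x)).
  { intros f f' H x Dx.
    apply (is_derive_within_subset (V := R_CompleteNormedModule) (Icc (- eta) (1 + eta)));
      [exact Hsub|exact Dx|]. apply H, Hsub, Dx. }
  (* Uniqueness of the derivative identifies [D_on] in the hypothesis with the witnesses [A1] and
     [C1]. *)
  assert (Hon : forall x, Icc (- eta) (1 + eta) x ->
    D_on (- eta) (1 + eta) fA x + D_on (- eta) (1 + eta) fC x = A1 x + C1 x).
  { intros x Dx. unfold D_on.
    rewrite (Derive_within_correct (V := R_CompleteNormedModule) _ _ fA x (A1 x))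
      by (auto; lra).
    rewrite (Derive_within_correct (V := R_CompleteNormedModule) _ _ fC x (C1 x))
      by (auto; lra). reflexivity. }
  assert (Hend : forall x, - eta <= x <= 0 \/ 1 <= x <= 1 + eta ->
    h * Rabs (A1 x + C1 x) < Rabs (fA x - fC x)).
  { intros x Hx. specialize (HN0d x Hx).
    rewrite Hon in HN0d by (unfold Icc; lra).
    pose proof (Rabs_pos (fA x - fC x)).
    apply Rlt_le_trans with (h * (2 * INR N0 * Rabs (fA x - fC x))).
    - apply Rmult_lt_compat_l; lra.
    - nra. }
  assert (HUQ : 0 <= U / Q) by (apply Rdiv_le_0_compat; lra).
  assert (Hdiv : forall j, (j <= N)%nat -> 0 <= INR j / INR N <= 1).
  { intros n Hn. apply le_INR in Hn. pose proof (pos_INR n). split.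
    - apply Rdiv_le_0_compat; lra.
    - apply Rmult_le_reg_r with (INR N); [exact HNp|].
      unfold Rdiv. rewrite Rmult_assoc, Rinv_l; lra. }
  assert (HuQ : forall x, 0 <= x <= 1 -> Rabs (u0 x / Q) <= U / Q).
  { intros x Hx. unfold Rdiv. rewrite Rabs_mult, (Rabs_pos_eq (/ Q))
      by (apply Rlt_le, Rinv_0_lt_compat, HQ).
    apply Rmult_le_compat_r; [apply Rlt_le, Rinv_0_lt_compat, HQ|]. now apply HU. }
  assert (Hv : Cmod (S t (fun z => RtoC (ext0 u0 z / Q)) (INR k / INR N))
    <= exp (2 * w * t) * (U / Q)).
  { apply (FP_semigroup_growth fA fC A1 A2 C1 C2 N w HNpos); auto.
    - exact (continuous_on_subset _ _ _ Hsub CA).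
    - exact (continuous_on_subset _ _ _ Hsub CC).
    - unfold w; lra.
    - intros x Dx. fold h. apply Hsub in Dx. unfold w.
      pose proof (proj1 (Rabs_le_between _ _) (HMA1 x Dx)).
      pose proof (proj1 (Rabs_le_between _ _) (HMC1 x Dx)).
      pose proof (proj1 (Rabs_le_between _ _) (HMA2 x Dx)).
      pose proof (proj1 (Rabs_le_between _ _) (HMC2 x Dx)).
      assert (h * (A2 x + C2 x) <= h * (MA2 + MC2)) by (apply Rmult_le_compat_l; lra).
      assert (h * (MA2 + MC2) <= 1 * (MA2 + MC2)) by (apply Rmult_le_compat_r; lra).
      lra.
    - intros x Dx. apply Hpos, Hsub, Dx.
    - fold h. rewrite <- (Rabs_pos_eq (fA (- h) - fC (- h))) by (apply Rlt_le, Hl; lra).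
      apply Hend; lra.
    - fold h. specialize (Hend (1 + h) ltac:(lra)). specialize (Hr (1 + h) ltac:(lra)).
      rewrite (Rabs_left (fA (1 + h) - fC (1 + h))) in Hend by exact Hr. lra.
    - apply (ext0_scaled_FP_dom fA fC A1 C1 N HNpos); auto.
    - intros x Dx. rewrite Cmod_R. unfold ext0.
      assert (H0 : Rabs (0 / Q) <= U / Q)
        by (unfold Rdiv at 1; rewrite Rmult_0_l, Rabs_R0; exact HUQ).
      destruct (Rle_dec 0 x); [destruct (Rle_dec x 1)|]; auto.
    - lra.
    - specialize (Hdiv k Hk). unfold dom_interval, Icc. fold h. lra. }
  (* The factor N in the rates cancels the grid spacing 1 / N, so the bound is independent of N. *)
  assert (Hlip : forall f f' M, (forall x, Icc (- eta) (1 + eta) x ->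
      is_derive_within (V := R_CompleteNormedModule) (Icc (- eta) (1 + eta)) f x (f' x)) ->
      (forall x, Icc (- eta) (1 + eta) x -> Rabs (f' x) <= M) ->
      forall j, (j < N)%nat ->
      Rabs (INR N * f (INR (Datatypes.S j) / INR N) - INR N * f (INR j / INR N)) <= M).
  { intros f f' M H HM j Hj.
    pose proof (Hdiv j ltac:(lia)) as D1. pose proof (Hdiv (Datatypes.S j) Hj) as D2.
    assert (E : INR (Datatypes.S j) / INR N - INR j / INR N = / INR N)
      by (rewrite S_INR; field; lra).
    pose proof (Rinv_0_lt_compat _ HNp) as Hi.
    pose proof (derivative_bound_lipschitz (- eta) (1 + eta) M f f' (INR j / INR N)
      (INR (Datatypes.S j) / INR N) H HM ltac:(lra) ltac:(lra) ltac:(lra)) as HL.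
    rewrite E in HL. rewrite <- Rmult_minus_distr_l, Rabs_mult, (Rabs_pos_eq (INR N)) by lra.
    apply Rmult_le_reg_r with (/ INR N); [exact Hi|].
    replace (INR N * Rabs (f (INR (Datatypes.S j) / INR N) - f (INR j / INR N)) * / INR N)
      with (Rabs (f (INR (Datatypes.S j) / INR N) - f (INR j / INR N))) by (field; lra).
    exact HL. }
  assert (Hpk : Rabs (p k t) <= exp (L * t) * (U / Q)).
  { unfold L. apply (master_solution_bound fA fC N MA1 MC1 MA1p MC1p) with
      (p0 := fun k => u0 (INR k / INR N) / Q); auto.
    - intros j Hj. apply Rmult_le_pos; [lra|]. apply Hnn, Hdiv, Hj.
    - intros j Hj. apply Rmult_le_pos; [lra|]. apply Hnn, Hdiv, Hj.
    - intros j Hj. unfold rate_up. specialize (Hlip fA A1 MA1 HA1 HMA1 j Hj).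
      apply Rabs_le_between in Hlip. lra.
    - intros j Hj. unfold rate_down. specialize (Hlip fC C1 MC1 HC1 HMC1 j Hj).
      apply Rabs_le_between in Hlip. lra.
    - lra. }
  assert (Hexp : forall z, 0 <= z -> exp (z * t) <= exp (z * t0)).
  { intros z Hz. destruct (Rle_lt_or_eq_dec (z * t) (z * t0)) as [h1|h1].
    - apply Rmult_le_compat_l; lra.
    - apply Rlt_le, exp_increasing, h1.
    - rewrite h1; lra. }
  assert (HQN : U / Q <= U / c / INR N).
  { unfold Rdiv. rewrite Rmult_assoc. apply Rmult_le_compat_l; [exact Up|].
    rewrite <- Rinv_mult. apply Rinv_le_contravar; [|apply Hc, HQ].
    now apply Rmult_lt_0_compat. }
  unfold Cminus. eapply Rle_trans; [apply Cmod_triangle|]. rewrite Cmod_opp, Cmod_R.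
  replace ((exp (2 * w * t0) + exp (L * t0)) * U / c / INR N)
    with (exp (2 * w * t0) * (U / c / INR N) + exp (L * t0) * (U / c / INR N)) by (field; lra).
  apply Rplus_le_compat.
  - eapply Rle_trans; [exact Hv|].
    apply Rmult_le_compat; [apply Rlt_le, exp_pos|exact HUQ| |exact HQN].
    apply Hexp. unfold w; lra.
  - eapply Rle_trans; [exact Hpk|].
    apply Rmult_le_compat; [apply Rlt_le, exp_pos|exact HUQ| |exact HQN].
    apply Hexp. unfold L; lra.
Qed.
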